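(* If $G=M_{24}$ is the Mathieu simple group of degree $24$, then $\pi(G)=\pi(V(\mathbb{Z}G))$, where $\pi$ denotes the Gruenberg--Kegel (prime) graph and $V(\mathbb{Z}G)$ is the normalized unit group of the integral group ring $\mathbb{Z}G$.
   Context: For a finite group $G$, $V(\mathbb{Z}G)$ denotes the group of normalized units of $\mathbb{Z}G$, i.e. the units $\sum_g\alpha_g g$ with $\sum_g\alpha_g=1$. The Gruenberg--Kegel graph (prime graph) $\pi(X)$ of a group $X$ is the graph whose vertices are labelled by the primes $p$ which divide the order of $X$ (for the possibly infinite group $X=V(\mathbb{Z}G)$: the primes $p$ for which $X$ contains an element of order $p$; for finite $X$ the two descriptions agree), with an edge between distinct primes $p$ and $q$ if there is an element of order $pq$ in $X$. Equality of the graphs means that they have the same vertices and the same edges. *)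

(* Defs.v *)
From HB Require Import structures.
From mathcomp Require Import all_boot all_order all_algebra all_fingroup all_solvable.

Set Implicit Arguments.
Unset Strict Implicit.
Unset Printing Implicit Defensive.

Import GRing.Theory.
Local Open Scope ring_scope.

(* The group ring R[G]: the element \sum_g u_g g is the function g |-> u_g,
   with the convolution product. *)
Definition group_alg (R : nzRingType) (gT : finGroupType) : Type :=
  {ffun gT -> R}.

HB.instance Definition _ (R : nzRingType) (gT : finGroupType) :=
  GRing.Zmodule.on (group_alg R gT).

Section GroupAlgebra.
Variables (R : nzRingType) (gT : finGroupType).
Implicit Types u v w : group_alg R gT.

(* The basis element a g, for a in R and g in G. *)
Definition galg_mon (a : R) (g : gT) : group_alg R gT :=
  [ffun h => if h == g then a else 0].

Definition galg_one : group_alg R gT := galg_mon 1 1%g.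

Definition galg_mul u v : group_alg R gT :=
  [ffun g => \sum_(h : gT) u h * v (h^-1 * g)%g].

Fact galg_mulA : associative galg_mul.
Proof.
move=> u v w; apply/ffunP=> g; rewrite !ffunE.
under eq_bigr => h _ do rewrite ffunE mulr_sumr.
under [RHS]eq_bigr => k _ do rewrite ffunE mulr_suml.
rewrite [RHS]exchange_big; apply: eq_bigr => h _ /=.
rewrite [RHS](reindex_inj (mulgI h)); apply: eq_bigr => k _ /=.
by rewrite mulrA mulKg invMg mulgA.
Qed.

Fact galg_mul1 : left_id galg_one galg_mul.
Proof.
move=> u; apply/ffunP=> g; rewrite ffunE (bigD1 1%g) //= ffunE eqxx mul1r.
rewrite invg1 mul1g big1 ?addr0 // => h /negPf h1.
by rewrite ffunE h1 mul0r.
Qed.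

Fact galg_mulr1 : right_id galg_one galg_mul.
Proof.
move=> u; apply/ffunP=> g; rewrite ffunE (bigD1 g) //= ffunE mulVg eqxx mulr1.
rewrite big1 ?addr0 // => h hg; rewrite ffunE -eq_mulVg1.
by rewrite (negPf hg) mulr0.
Qed.

Fact galg_mulDl : left_distributive galg_mul +%R.
Proof.
move=> u v w; apply/ffunP=> g; rewrite !ffunE -big_split /=.
by apply: eq_bigr => h _; rewrite ffunE mulrDl.
Qed.

Fact galg_mulDr : right_distributive galg_mul +%R.
Proof.
move=> u v w; apply/ffunP=> g; rewrite !ffunE -big_split /=.
by apply: eq_bigr => h _; rewrite ffunE mulrDr.
Qed.

Fact galg_one_neq0 : galg_one != 0.
Proof.
by apply/eqP=> /ffunP/(_ 1%g)/eqP; rewrite !ffunE eqxx oner_eq0.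
Qed.

HB.instance Definition _ := GRing.Zmodule_isNzRing.Build (group_alg R gT)
  galg_mulA galg_mul1 galg_mulr1 galg_mulDl galg_mulDr galg_one_neq0.

Definition augmentation u : R := \sum_(g : gT) u g.

Fact augmentation1 : augmentation 1 = 1.
Proof.
rewrite /augmentation (bigD1 1%g) //= ffunE eqxx big1 ?addr0 // => h /negPf h1.
by rewrite ffunE h1.
Qed.

Fact augmentationM u v :
  augmentation (u * v) = augmentation u * augmentation v.
Proof.
rewrite /augmentation mulr_suml; under eq_bigr => g _ do rewrite ffunE.
rewrite exchange_big; apply: eq_bigr => h _ /=.
by rewrite -mulr_sumr; congr (_ * _); rewrite (reindex_inj (mulgI h)) /=;
  apply: eq_bigr => g _; rewrite mulKg.
Qed.

End GroupAlgebra.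

(* V(ZG).  A normalized unit is represented as the pair (u, u^-1) of two-sided
   inverse elements of ZG with u of augmentation 1; since inverses are unique,
   nu_elt is injective. *)
Section NormalizedUnits.
Variable gT : finGroupType.
Local Notation ZG := (group_alg int gT).

Record norm_unit := NormUnit {
  nu_pair :> ZG * ZG;
  _ : [&& augmentation nu_pair.1 == 1,
          nu_pair.1 * nu_pair.2 == 1 & nu_pair.2 * nu_pair.1 == 1] }.

HB.instance Definition _ := [isSub for nu_pair].
HB.instance Definition _ := [Choice of norm_unit by <:].

Implicit Types x y z : norm_unit.

Definition nu_elt x : ZG := (nu_pair x).1.

Fact nu_spec x : [/\ augmentation x.1 = 1, x.1 * x.2 = 1 & x.2 * x.1 = 1].
Proof. by case: x => -[u v] /= /and3P[/eqP ? /eqP ? /eqP ?]. Qed.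

Fact nu_elt_inj : injective nu_elt.
Proof.
move=> x y eq_xy; apply/val_inj.
case: (nu_spec x) (nu_spec y) => _ _ Vx [_ yV _].
move: eq_xy Vx yV; rewrite /nu_elt /=.
case: (nu_pair x) (nu_pair y) => [u v] [u' v'] /= <- vu uv'.
by congr (_, _); rewrite -[v]mulr1 -uv' mulrA vu mul1r.
Qed.

Fact nu_one_subproof :
  let p : ZG * ZG := (1, 1) in
  [&& augmentation p.1 == 1, p.1 * p.2 == 1 & p.2 * p.1 == 1].
Proof. by rewrite /= augmentation1 mulr1 !eqxx. Qed.

Fact nu_mul_subproof x y :
  let p : ZG * ZG := (x.1 * y.1, y.2 * x.2) in
  [&& augmentation p.1 == 1, p.1 * p.2 == 1 & p.2 * p.1 == 1].
Proof.
case: (nu_spec x) (nu_spec y) => ax xV Vx [ay yV Vy] /=.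
rewrite augmentationM ax ay mulr1 eqxx /=.
by rewrite !mulrA -(mulrA x.1) yV mulr1 xV -(mulrA y.2) Vx mulr1 Vy eqxx.
Qed.

Fact nu_inv_subproof x :
  let p : ZG * ZG := (x.2, x.1) in
  [&& augmentation p.1 == 1, p.1 * p.2 == 1 & p.2 * p.1 == 1].
Proof.
case: (nu_spec x) => ax xV Vx /=; rewrite xV Vx !eqxx !andbT.
by rewrite -(augmentation1 int gT) -xV augmentationM ax mul1r.
Qed.

Definition nu_one : norm_unit := NormUnit nu_one_subproof.
Definition nu_mul x y : norm_unit := NormUnit (nu_mul_subproof x y).
Definition nu_inv x : norm_unit := NormUnit (nu_inv_subproof x).

Fact nu_mulA : associative nu_mul.
Proof. by move=> x y z; apply: nu_elt_inj; rewrite /nu_elt /= mulrA. Qed.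

Fact nu_mul1 : left_id nu_one nu_mul.
Proof. by move=> x; apply: nu_elt_inj; rewrite /nu_elt /= mul1r. Qed.

Fact nu_mulr1 : right_id nu_one nu_mul.
Proof. by move=> x; apply: nu_elt_inj; rewrite /nu_elt /= mulr1. Qed.

Fact nu_mulV : left_inverse nu_one nu_inv nu_mul.
Proof.
by move=> x; apply: nu_elt_inj; rewrite /nu_elt /=; case: (nu_spec x).
Qed.

Fact nu_mulrV : right_inverse nu_one nu_inv nu_mul.
Proof.
by move=> x; apply: nu_elt_inj; rewrite /nu_elt /=; case: (nu_spec x).
Qed.

HB.instance Definition _ := isGroup.Build norm_unit
  nu_mulA nu_mul1 nu_mulr1 nu_mulV nu_mulrV.

Fact nu_elt_surj (u v : ZG) :
  augmentation u = 1 -> u * v = 1 -> v * u = 1 -> exists x, nu_elt x = u.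
Proof.
move=> au uv vu.
have p : [&& augmentation (u, v).1 == 1, (u, v).1 * (u, v).2 == 1
           & (u, v).2 * (u, v).1 == 1] by rewrite /= au uv vu !eqxx.
by exists (NormUnit p).
Qed.

Fact nu_eltX x n : nu_elt (x ^+ n)%g = nu_elt x ^+ n.
Proof. by elim: n => // n IHn; rewrite expgS exprS -IHn. Qed.

End NormalizedUnits.

Section PrimeGraph.
Local Open Scope group_scope.

Definition elt_order (X : groupType) (x : X) (n : nat) : Prop :=
  [/\ (0 < n)%N, x ^+ n = 1 & forall k, (0 < k < n)%N -> x ^+ k <> 1].

Definition gk_vertex (X : groupType) (p : nat) : Prop :=
  prime p /\ exists x : X, elt_order x p.

Definition gk_edge (X : groupType) (p q : nat) : Prop :=
  [/\ prime p, prime q, p <> q & exists x : X, elt_order x (p * q)].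

Definition same_prime_graph (X Y : groupType) : Prop :=
  (forall p, gk_vertex X p <-> gk_vertex Y p) /\
  (forall p q, gk_edge X p q <-> gk_edge Y p q).

Fact elt_orderE (gT : finGroupType) (x : gT) n : elt_order x n <-> #[x] = n.
Proof.
split=> [[n0 xn lt_n] | <-].
  apply/eqP; rewrite eqn_leq dvdn_leq ?order_dvdn ?xn //=.
  rewrite leqNgt; apply/negP=> ltxn.
  by case: (lt_n #[x]); rewrite ?order_gt0 ?expg_order.
split=> [||k /andP[k0 ltk] /eqP]; rewrite ?order_gt0 ?expg_order //.
by rewrite -order_dvdn => /(dvdn_leq k0); rewrite leqNgt ltk.
Qed.

(* For a finite group the vertices are the prime divisors of the order. *)
Fact gk_vertex_fin (gT : finGroupType) p :
  gk_vertex gT p <-> prime p /\ (p %| #|gT|)%N.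
Proof.
split=> -[p_pr]; rewrite -cardsT.
  by case=> x /elt_orderE ox; split=> //; rewrite -ox order_dvdG ?inE.
by case/(Cauchy p_pr) => x _ ox; split=> //; exists x; apply/elt_orderE.
Qed.

End PrimeGraph.

Section Mathieu.
Local Open Scope group_scope.

(* The cycle (x y_1 ... y_n); products of permutations act left to right. *)
Definition cycp (s : seq nat) : 'S_24 :=
  \prod_(y <- behead s) tperm (inord (head 0%N s)) (inord y).

(* Conway's generators of M_24 on the projective line over F_23, with the
   point at infinity labelled 23:
     alpha : x |-> x + 1,   gamma : x |-> - 1 / x,
     delta : x |-> x^3 / 9 if x is 0, infinity or a nonzero square,
             x |-> 9 x^3 otherwise. *)
Definition M24_alpha : 'S_24 := cycp (iota 0 23).

Definition M24_gamma : 'S_24 :=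
  \prod_(c <- [:: [:: 0; 23]; [:: 1; 22]; [:: 2; 11]; [:: 3; 15];
                  [:: 4; 17]; [:: 5; 9]; [:: 6; 19]; [:: 7; 13];
                  [:: 8; 20]; [:: 10; 16]; [:: 12; 21]; [:: 14; 18]]%N) cycp c.

Definition M24_delta : 'S_24 :=
  \prod_(c <- [:: [:: 1; 18; 4; 2; 6]; [:: 5; 21; 20; 10; 7];
                  [:: 8; 16; 13; 9; 12]; [:: 11; 19; 22; 14; 17]]%N) cycp c.

Definition M24 : {group 'S_24} :=
  <<[set M24_alpha; M24_gamma; M24_delta]>>%G.

End Mathieu.

(* Main.v *)
Require Import Defs.
From mathcomp Require Import all_boot all_order all_algebra all_fingroup all_solvable.
From mathcomp Require Import all_field zify ring.

(** Write G for the given group, isomorphic to M24.  The inclusion of G in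
    V(ZG) shows that every vertex and every edge of the prime graph of G
    belongs to that of V(ZG).  The converse restricts the torsion units u of
    augmentation 1.

    A class function f of G extends linearly to ZG (extend), with value at u
    the sum of u_g f(g).  Two facts control it.  First, u_1 = 0 unless u = 1
    (berman_higman): the trace of multiplication by u on ZG is |G| u_1, and a
    sum of |G| roots of unity has absolute value |G| only if they all agree.
    Secondly, the coefficients of u over a conjugacy class add up to 0 when
    the order of the elements of this class does not divide the order of u
    (conj_sum_eq0, a theorem of Hertweck).  Hence f(u) depends only on the
    values of f at the nontrivial elements of G whose order divides that of u
    (extend_eq); applied to constant functions, this shows that a unit of
    prime order p exists only if G has an element of order p, which settles
    the vertices.

    Hertweck's theorem comes from the map m |-> x^-1 m u of ZG, whose trace is
    a multiple of the coefficient sum of u over the class of x.  If the p-part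
    of the order of x exceeds that of u, some power of this map is the left
    multiplication by an element of order p, which permutes the basis G
    freely.  A rank computation modulo p shows that the eigenvalues are then
    permuted, with their multiplicities, by multiplication by a primitive p-th
    root of unity, so that the trace is 0 (free_trace_zero).

    For the edges, let u have order pq and suppose that G has no element of
    this order.  A permutation representation of G extends to ZG and maps u to
    an integral matrix of finite order, in which eigenvalues of the same order
    have the same multiplicity.  The four multiplicities for the orders 1, p,
    q and pq are natural numbers which determine the character at 1, u, u^p
    and u^q (perm_char_multiplicities).  On the other hand these character
    values are linear in a few coefficient sums of u, since the number of
    points fixed by an element of M24 of prime order p takes only one or two
    values (M24_prime_fix).  For the actions on the 24 points and on the 576
    ordered pairs of points, the resulting linear systems have no solution for
    pq = 22, 33, 35, 46, 55, 69, 77, 115, 161 and 253; for 22 a congruence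
    modulo 2 between u and u^2 is also used (extend_square).  The remaining
    products 6, 10, 14, 15 and 21 of two primes are orders of explicit words in
    the generators of M24 (M24_element_orders).

    The data on M24 are obtained by computing with permutations given as lists.
    A stabiliser chain, checked with Schreier's lemma, bounds M24 from above
    and is transitive enough for every element fixing three points to be
    conjugate to one of an explicit list. *)

Set Implicit Arguments.
Unset Strict Implicit.
Unset Printing Implicit Defensive.

(** * Permutations of 24 points as lists *)
Section Mathieu24.
Local Open Scope group_scope.

Section Codes.
Implicit Types (s t : 'S_24) (l : seq nat).

(** Products of permutations in ['S_24] do not evaluate; lists of images do. *)
Definition code s : seq nat := [seq val (s i) | i <- enum 'I_24].
Definition id24 := iota 0 24.
Definition codeM (l m : seq nat) := [seq nth 0 m i | i <- l].
Definition codeV l := [seq index i l | i <- id24].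

Lemma size_code s : size (code s) = 24.
Proof. by rewrite size_map size_enum_ord. Qed.

Lemma nth_code s (i : 'I_24) : nth 0 (code s) i = s i.
Proof. by rewrite (nth_map i) ?size_enum_ord ?ltn_ord // nth_ord_enum. Qed.

Lemma code_eq s l :
  size l = 24 -> (forall i : 'I_24, nth 0 l i = s i) -> code s = l.
Proof.
move=> szl eqi; apply: (@eq_from_nth _ 0); rewrite size_code ?szl // => i lti.
by have:= eqi (Ordinal lti); rewrite /= => ->; apply: (nth_code s (Ordinal lti)).
Qed.

Lemma code_inj : injective code.
Proof.
by move=> s t eq_st; apply/permP=> i; apply: val_inj; rewrite /= -(nth_code s) eq_st nth_code.
Qed.

Lemma code_mul s t : code (s * t) = codeM (code s) (code t).
Proof.
apply: code_eq => [|i]; first by rewrite size_map size_code.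
by rewrite (nth_map 0) ?size_code // !nth_code permM.
Qed.

Lemma code_one : code 1 = id24.
Proof. by apply: code_eq => // i; rewrite nth_iota // perm1. Qed.

Lemma code_inv s : code s^-1 = codeV (code s).
Proof.
apply: code_eq => // i; rewrite (nth_map 0) ?size_iota // nth_iota //= add0n.
rewrite -[in LHS](permKV s i) -nth_code index_uniq ?size_code //.
rewrite map_inj_uniq ?enum_uniq // => j k /val_inj; exact: perm_inj.
Qed.

Lemma code_exp s n : code (s ^+ n) = iter n (codeM (code s)) id24.
Proof. by elim: n => [|n IHn]; rewrite ?code_one // expgS code_mul IHn. Qed.

Lemma code_onto l : perm_eq l id24 -> exists s, code s = l.
Proof.
move=> l_id; have szl: size l = 24 by rewrite (perm_size l_id).
have ltl (i : 'I_24) : nth 0 l i < 24.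
  have: nth 0 l i \in id24 by rewrite -(perm_mem l_id) mem_nth ?szl.
  by rewrite mem_iota.
have inj_f: injective (fun i : 'I_24 => Ordinal (ltl i)).
  move=> i j /(congr1 val)/= /eqP; rewrite nth_uniq ?szl //; last first.
    by rewrite (perm_uniq l_id) iota_uniq.
  by move/eqP/val_inj.
by exists (perm inj_f); apply: code_eq => // i; rewrite permE.
Qed.

Definition fixcount l := count (fun i => nth 0 l i == i) id24.

Lemma fixcount_code s : fixcount (code s) = #|[set i | s i == i]|.
Proof.
rewrite /fixcount /id24 -val_enum_ord count_map cardsE cardE size_filter enumT.
by apply: eq_count => i; rewrite /= nth_code unfold_in.
Qed.

Definition transp a b :=
  [seq if i == a then b else if i == b then a else i | i <- id24].

Lemma code_tperm a b : a < 24 -> b < 24 ->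
  code (tperm (inord a) (inord b)) = transp a b.
Proof.
move=> lta ltb; apply: code_eq => // i.
rewrite (nth_map 0) ?size_iota // nth_iota //= add0n.
case: tpermP => [->|->|/eqP ia /eqP ib]; rewrite ?inordK ?eqxx //.
  by case: eqP => // ->.
have neq (c : 'I_24) x : x < 24 -> c != inord x -> (val c == x) = false.
  by move=> ltx; apply: contraNF => /eqP <-; rewrite inord_val.
by rewrite !neq.
Qed.

Lemma code_cycp l : all (gtn 24) l ->
  code (cycp l) = foldr (fun y => codeM (transp (head 0 l) y)) id24 (behead l).
Proof.
case: l => [|x l] /=; first by rewrite /cycp big_nil code_one.
case/andP=> ltx; rewrite /cycp /=.
elim: l => [|y l IHl] /=; first by rewrite big_nil code_one.
by case/andP=> lty /IHl; rewrite big_cons code_mul code_tperm // => ->.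
Qed.

End Codes.

(** * A stabiliser chain containing M24 *)
Definition code_alpha := rcons (rcons (iota 1 22) 0) 23.
Definition code_gamma :=
  [:: 23; 22; 11; 15; 17; 9; 19; 13; 20; 5; 16; 2; 21; 7; 18; 3; 10; 4; 14;
      6; 8; 12; 1; 0]%N.
Definition code_delta :=
  [:: 0; 18; 6; 3; 2; 21; 1; 5; 16; 12; 7; 19; 8; 9; 17; 15; 13; 11; 4; 22;
      10; 20; 14; 23]%N.
(** The base is 0, 1, .., 6.  The seven additional permutations come from a
    randomised Schreier-Sims search, and are chosen so that the members of the
    list fixing 0, .., i - 1 generate the pointwise stabiliser of these points.
    Adding generators can only enlarge the group, so that statements about all
    elements of the group generated here hold in M24. *)
Definition strong_gens : seq (seq nat) := [::
[:: 0; 1; 2; 3; 4; 5; 16; 10; 13; 19; 12; 8; 7; 11; 23; 20; 21; 14; 9; 18; 22; 6; 15; 17];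
[:: 0; 1; 2; 3; 4; 20; 19; 7; 9; 8; 10; 16; 12; 17; 18; 22; 11; 13; 14; 6; 5; 23; 15; 21];
[:: 0; 1; 2; 3; 4; 23; 11; 7; 15; 22; 10; 6; 12; 18; 17; 8; 19; 14; 13; 16; 21; 20; 9; 5];
[:: 0; 1; 2; 3; 22; 15; 12; 9; 17; 7; 11; 10; 6; 13; 19; 5; 23; 8; 18; 14; 20; 21; 4; 16];
[:: 0; 1; 2; 19; 4; 13; 8; 5; 20; 16; 18; 15; 9; 7; 14; 17; 12; 11; 23; 22; 6; 21; 3; 10];
[:: 0; 1; 14; 3; 8; 17; 4; 21; 20; 15; 11; 13; 7; 19; 2; 16; 22; 5; 12; 10; 6; 18; 9; 23];
[:: 0; 12; 9; 14; 8; 10; 1; 7; 5; 2; 4; 16; 18; 22; 3; 13; 17; 23; 6; 19; 20; 15; 21; 11];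
code_alpha; code_gamma; code_delta]%N.

Lemma code_M24_alpha : code M24_alpha = code_alpha.
Proof. by rewrite code_cycp //; vm_compute. Qed.

Lemma code_M24_gamma : code M24_gamma = code_gamma.
Proof. by rewrite /M24_gamma !big_cons big_nil !code_mul !code_cycp ?code_one. Qed.

Lemma code_M24_delta : code M24_delta = code_delta.
Proof. by rewrite /M24_delta !big_cons big_nil !code_mul !code_cycp ?code_one. Qed.

Definition level_gens i :=
  [seq l <- strong_gens | all (fun j => nth 0 l j == j) (iota 0 i)].

Definition extend_reps (b : nat) (S U : seq (seq nat)) :=
  foldl (fun V l =>
    if has (fun u => nth 0 u b == nth 0 l b) V then V else rcons V l)
    U [seq codeM u s | u <- U, s <- S].

(** A transversal for the point stabiliser of i in the group generated by the
    members of the list that fix 0, .., i - 1, by breadth-first search; words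
    of length 6 reach the whole orbit at every level. *)
Definition reps i := iter 6 (extend_reps i (level_gens i)) [:: id24].
Definition rep_table := [seq reps i | i <- iota 0 7].

(** Divides by representatives, level after level, and tests whether the
    identity remains. *)
Fixpoint sift i (T : seq (seq (seq nat))) (l : seq nat) : bool :=
  if T is U :: T' then
    if ohead [seq u <- U | nth 0 u i == nth 0 l i] is Some u
    then sift i.+1 T' (codeM l (codeV u)) else false
  else l == id24.

(** The condition of Schreier's lemma: every product of a representative and a
    generator sifts to the identity. *)
Definition level_closed i :=
  all (fun u => all (fun s => sift i (drop i rep_table) (codeM u s))
                    (level_gens i)) (reps i).

Arguments reps : simpl never.
Arguments rep_table : simpl never.
Arguments level_gens : simpl never.
Arguments id24 : simpl never.
Arguments drop : simpl never.

Lemma sift_cons i U T l : sift i (U :: T) l =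
  if ohead [seq u <- U | nth 0 u i == nth 0 l i] is Some u
  then sift i.+1 T (codeM l (codeV u)) else false.
Proof. by []. Qed.

Lemma all_level_closed i : i < 7 -> level_closed i.
Proof.
have: all level_closed (iota 0 7) by vm_compute.
by move/allP=> chk lti; apply: chk; rewrite mem_iota.
Qed.

Lemma reps_fix i u : i < 7 -> u \in reps i -> nth 0 u i = i -> u = id24.
Proof.
have: all (fun i => all (fun u => (nth 0 u i == i) ==> (u == id24)) (reps i))
          (iota 0 7) by vm_compute.
move/allP=> chk lti; have /chk/allP chki: i \in iota 0 7 by rewrite mem_iota.
by move=> /chki/implyP fixu /eqP/fixu/eqP.
Qed.

Lemma reps_move i a : i <= a < 24 -> i < 5 ->
  exists2 u, u \in reps i & nth 0 u i = a.
Proof.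
have: all (fun i => all (fun a => has (fun u => nth 0 u i == a) (reps i))
                        (iota i (24 - i))) (iota 0 5) by vm_compute.
move/allP=> chk ia lti; have /chk/allP chki: i \in iota 0 5 by rewrite mem_iota.
have /chki/hasP[u Uu /eqP]: a \in iota i (24 - i).
  by rewrite mem_iota subnKC //; apply/leq_trans/(_ : 5 <= 24)=> //; apply: ltnW.
by exists u.
Qed.

Definition level i : {group 'S_24} :=
  <<[set s | code s \in level_gens i]>>%G.

Lemma level_ind i (P : 'S_24 -> Prop) :
  P 1 -> (forall s t, P s -> code t \in level_gens i -> P (s * t)) ->
  forall s, s \in level i -> P s.
Proof.
move=> P1 PM s /gen_prodgP[n [c c_gen ->]].
elim: n c c_gen => [|n IHn] c c_gen; first by rewrite big_ord0.
rewrite big_ord_recr /=; apply: PM; first by apply: IHn => j; apply: c_gen.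
by have:= c_gen ord_max; rewrite inE.
Qed.

Lemma level_gen i t : code t \in level_gens i -> t \in level i.
Proof. by move=> ti; rewrite mem_gen ?inE. Qed.

Lemma level_sub i j : i <= j -> level j \subset level i.
Proof.
move=> leij; apply/genS/subsetP=> s; rewrite !inE !mem_filter.
case/andP=> /allP fixj ->; rewrite andbT; apply/allP=> k.
by rewrite mem_iota add0n => /leq_trans/(_ leij) ltk; rewrite fixj ?mem_iota.
Qed.

Lemma level_fix i s (j : 'I_24) : s \in level i -> j < i -> s j = j.
Proof.
move=> si ltji; elim/level_ind: si => [|{}s t sj]; first by rewrite perm1.
rewrite mem_filter => /andP[/allP/(_ j)]; rewrite mem_iota ltji => /(_ isT) /=.
by rewrite nth_code => /eqP/val_inj tj _; rewrite permM sj.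
Qed.

Lemma reps_level i u : u \in reps i -> exists2 s, s \in level i & code s = u.
Proof.
pose inL (U : seq (seq nat)) := forall u, u \in U -> exists2 s, s \in level i & code s = u.
suff grow (U : seq (seq nat)) : inL U -> inL (extend_reps i (level_gens i) U).
  have inL0: inL [:: id24].
    by move=> v; rewrite inE => /eqP->; exists 1; rewrite ?code_one.
  by rewrite /reps; move: u; do !apply: (grow).
move=> UL; rewrite /extend_reps.
have: inL [seq codeM u s | u <- U, s <- level_gens i].
  move=> _ /allpairsP[[v w] /= [/UL[s si <-] wi ->]].
  have [t def_w]: exists t, code t = w.
    apply: code_onto; move: wi; rewrite mem_filter => /andP[_].
    by move: (w); apply/allP; vm_compute.
  exists (s * t); last by rewrite code_mul def_w.
  by rewrite groupM // level_gen // def_w.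
move: [seq codeM u s | u <- U, s <- _] => W; elim: W U UL => [|l W IHW] U UL lWL //=.
apply: IHW => [|v Wv]; last by apply: lWL; rewrite inE Wv orbT.
case: ifP => // _ v; rewrite mem_rcons inE => /predU1P[-> | /UL //].
by apply: lWL; rewrite mem_head.
Qed.

(** Sifting writes the permutation as a product of representatives. *)
Lemma sift_mem (K : {group 'S_24}) (T : seq (seq (seq nat))) :
    (forall (U : seq (seq nat)) u, U \in T -> u \in U -> exists2 s, s \in K & code s = u) ->
  forall i s, sift i T (code s) -> s \in K.
Proof.
elim: T => [_ i s /eqP|U T IHT TK i s] /=.
  by rewrite -code_one => /code_inj ->.
case def_u: (ohead _) => [u|] //.
have Uu: u \in U.
  have: u \in [seq u <- U | nth 0 u i == nth 0 (code s) i].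
    by case: (filter _ _) def_u => //= _ l [->]; rewrite mem_head.
  by rewrite mem_filter; case/andP.
have [|t Kt <-] := TK U u _ Uu; first by rewrite mem_head.
rewrite -code_inv -code_mul => /IHT sK.
rewrite -(groupMr s (groupVr Kt)); apply: sK => V v TV; apply: TK.
by rewrite inE TV orbT.
Qed.

Lemma drop_table i : i < 7 -> drop i rep_table = reps i :: drop i.+1 rep_table.
Proof.
move=> lti; rewrite (drop_nth [::]) ?size_map ?size_iota //.
by rewrite (nth_map 0) ?size_iota // nth_iota.
Qed.

Lemma drop_table_mem i U : U \in drop i rep_table ->
  exists2 j, i <= j & U = reps j.
Proof.
rewrite /rep_table -map_drop drop_iota => /mapP[j]; rewrite mem_iota => ij ->.
by exists j => //; case/andP: ij.
Qed.

(** Schreier's lemma: the products h * u contain 1 and are stable under right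
    multiplication by the generators t, because u * t = k * w for the
    representative w of the image of the base point, and k sifts to the
    identity through the later transversals, hence lies at the next level. *)
Lemma level_factor i s : i < 7 -> s \in level i ->
  exists h u, [/\ h \in level i.+1, code u \in reps i, u \in level i & s = h * u].
Proof.
move=> lti; elim/level_ind => [|{}s t].
  exists 1, 1; rewrite !group1 mulg1; split=> //.
  rewrite code_one; have: all (fun i => id24 \in reps i) (iota 0 7).
    by vm_compute.
  by move/allP; apply; rewrite mem_iota.
case=> h [u [hi ui _ ->]] ti.
have := all_level_closed lti; move/allP/(_ _ ui)/allP/(_ _ ti).
rewrite (drop_table lti) -code_mul sift_cons.
case def_v: (ohead _) => [v|] //.
have vi: v \in reps i.
  have: v \in [seq v <- reps i | nth 0 v i == nth 0 (code (u * t)) i].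
    by case: (filter _ _) def_v => //= _ l [->]; rewrite mem_head.
  by rewrite mem_filter; case/andP.
have [w wi def_w] := reps_level vi.
rewrite -def_w -code_inv -code_mul => /(@sift_mem (level i.+1)) kL.
exists (h * (u * t * w^-1)), w; split; rewrite ?def_w ?mulgA ?mulgKV //.
rewrite -!mulgA groupM // mulgA kL // => U v' /drop_table_mem[j ij ->].
by case/reps_level=> s' /(subsetP (level_sub ij)); exists s'.
Qed.

(** If s = h * u fixes the base point, so does u, and the only representative
    doing so is the identity. *)
Lemma level_stab i s (j : 'I_24) :
  j = i :> nat -> i < 7 -> s \in level i -> s j = j -> s \in level i.+1.
Proof.
move=> ji lti si sj; have [h [u [hi ui _ def_s]]] := level_factor lti si.
have hj: h j = j by apply: level_fix hi _; rewrite ji.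
have uj: u j = j by rewrite -[j in u j]hj -permM -def_s.
suff u1: u = 1 by rewrite def_s u1 mulg1.
apply: code_inj; rewrite code_one; apply: reps_fix lti ui _.
by rewrite -{1 2}ji nth_code uj.
Qed.

Definition level_list i :=
  foldr (fun U L => [seq codeM h u | h <- L, u <- U]) [:: id24]
        (drop i rep_table).

Lemma level_listP i s : i < 7 -> s \in level i -> code s \in level_list i.
Proof.
move=> lti; move: lti s; have [k] := ubnP (7 - i).
elim: k i => // k IHk i ltk lti s si.
have [h [u [hi ui _ ->]]] := level_factor lti si.
rewrite /level_list (drop_table lti) code_mul; apply: allpairs_f ui; last first.
have [lti1 | ge7] := ltnP i.+1 7.
  by apply: IHk => //; rewrite subnS -ltnS prednK ?subn_gt0.
have i1: i.+1 = 7 by apply/eqP; rewrite eqn_leq lti.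
rewrite i1 drop_oversize //= inE.
suff ->: h = 1 by rewrite code_one.
elim/level_ind: hi => // h' t ->; rewrite i1 mul1g => t7.
by have: code t \in [::] by move: t7; vm_compute.
Qed.

Lemma M24_level0 : M24 \subset level 0.
Proof.
rewrite gen_subG; apply/subsetP=> s; rewrite !inE => s_gen; apply: level_gen.
case/orP: s_gen => [/orP[]|] /eqP->;
  by rewrite ?code_M24_alpha ?code_M24_gamma ?code_M24_delta.
Qed.

(** * Fixed points of the elements of prime order of M24 *)
Definition nfix (T : finType) (s : {perm T}) := #|[set i | s i == i]|.

Lemma nfixJ (T : finType) (s t : {perm T}) : nfix (s ^ t) = nfix s.
Proof.
rewrite /nfix -[in RHS](card_imset _ (@perm_inj _ t)); apply: eq_card => i.
rewrite inE; apply/idP/imsetP => [|[j]]; last first.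
  by rewrite inE => /eqP sj ->; rewrite permJ sj.
move=> si; exists (t^-1 i); rewrite ?permKV // inE.
by rewrite -(inj_eq (@perm_inj _ t)) -permJ permKV.
Qed.

Lemma nfix_lt (T : finType) (s : {perm T}) : s != 1 -> nfix s < #|T|.
Proof.
rewrite -cardsT => s1; apply: proper_card; rewrite properT.
apply: contraNneq s1 => fixT; apply/eqP/permP=> i.
by have := in_setT i; rewrite -fixT inE perm1 => /eqP.
Qed.

Lemma nfix_mod (T : finType) (s : {perm T}) p : prime p -> #[s] = p ->
  #|T| = nfix s %[mod p].
Proof.
move=> p_pr os; have pG: p.-group <[s]> by rewrite /pgroup -orderE os pnat_id.
have sT : [acts <[s]>, on [set: T] | 'P] by apply/actsP=> a _ i; rewrite !inE.
rewrite -cardsT (pgroup_fix_mod pG sT) afix_cycle setTI.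
by congr (_ %% _); apply: eq_card => i; rewrite !inE sub1set inE.
Qed.

(** The number of cycles, which determines the sign, is the number of orbits of
    a group of order 2, hence is given by the Cauchy-Frobenius formula. *)
Lemma odd_involution (T : finType) (s : {perm T}) : #[s] = 2 ->
  odd_perm s = odd ((#|T| - nfix s)./2).
Proof.
move=> os; have sT : [acts <[s]>, on [set: T] | 'P] by apply/actsP=> a _ i; rewrite !inE.
have := Frobenius_Cauchy sT; rewrite -orderE os.
have le_fT: nfix s <= #|T| by rewrite max_card.
rewrite (eq_bigl (mem [set 1; s])) => [|a]; last by rewrite /= -(cycle2g os).
have s1: 1 != s by apply: contra_eq_neq os => <-; rewrite order1.
rewrite big_setU1 ?inE //= big_set1.
have -> : #|'Fix_([set: T] | 'P)[1]| = #|T|.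
  rewrite -cardsT; congr #|pred_of_set _|; apply/setP=> i.
  by rewrite !inE sub1set inE /= apermE perm1 eqxx.
have -> : #|'Fix_([set: T] | 'P)[s]| = nfix s.
  by congr #|pred_of_set _|; apply/setP=> i; rewrite !inE sub1set inE.
have -> : #|orbit 'P <[s]> @: [set: T]| = #|porbits s|.
  congr #|pred_of_set _|; apply/setP=> B.
  by apply/imsetP/imsetP=> -[x _ ->]; exists x; rewrite ?inE // porbitE.
move=> eqk; rewrite /odd_perm.
have -> : (#|T| - nfix s)./2 = #|T| - #|porbits s|.
  have e: #|T| - nfix s = (#|T| - #|porbits s|).*2.
    by move: eqk le_fT; lia.
  by rewrite e doubleK.
by rewrite oddB //; move: eqk le_fT; lia.
Qed.

(** An element of prime order p with f fixed points satisfies p | 24 - f.  For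
    f >= 3 the test leaves only f = 3, 4, 6 and 8, and excludes p = 3 for
    f = 3, and p = 2 for f = 4 and f = 6. *)
Definition fixpoint_ok l :=
  let f := fixcount l in let l2 := codeM l l in
  [|| f \in [:: 8; 24], (f == 3) && (codeM l2 l != id24)
    | (f \in [:: 4; 6]) && (l2 != id24)]%N.

Lemma level3_fixpoint_ok s : s \in level 3 -> fixpoint_ok (code s).
Proof.
have: all fixpoint_ok (level_list 3) by vm_compute.
by move/allP=> ok /level_listP s3; apply: ok; apply: s3.
Qed.

Lemma level_move i (a : 'I_24) : i <= a -> i < 5 ->
  exists2 t, t \in level i & t (inord i) = a.
Proof.
move=> leia lti; have [|u ui def_a] := @reps_move i a _ lti.
  by rewrite leia ltn_ord.
have [t ti def_u] := reps_level ui; exists t => //; apply: val_inj.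
by rewrite /= -def_a -def_u -nth_code inordK // (leq_trans lti).
Qed.

(** The image of 0 is adjusted first, then that of 1 by an element fixing 0,
    then that of 2 by an element fixing 0 and 1. *)
Lemma level0_3trans (a b c : 'I_24) : uniq [:: a; b; c] ->
  exists2 t, t \in level 0 &
    [/\ t (inord 0) = a, t (inord 1) = b & t (inord 2) = c].
Proof.
rewrite /= !inE negb_or !andbT => /andP[/andP[ab ac] bc].
have [t0 L0 ta] := @level_move 0 a isT isT.
have fix1 t j : t \in level j -> forall i, i < j -> j < 24 -> t (inord i) = inord i.
  move=> tj i ltij ltj; apply: (level_fix tj).
  by rewrite inordK // (ltn_trans ltij).
have [|t1 L1 tb] := @level_move 1 (t0^-1 b) _ isT.
  rewrite lt0n; apply: contraNneq ab => b0; rewrite -ta eq_sym -(inj_eq (@perm_inj _ t0^-1)).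
  by rewrite permK; apply/eqP/val_inj; rewrite /= b0 inordK.
have [|t2 L2 tc] := @level_move 2 (t1^-1 (t0^-1 c)) _ isT.
  have neq i : i < 2 -> t0 (t1 (inord i)) != c -> t1^-1 (t0^-1 c) != i :> nat.
    move=> lti; apply: contraNneq => eqi.
    have -> : inord i = t1^-1 (t0^-1 c).
      by apply: val_inj; rewrite /= eqi inordK // (leq_trans lti).
    by rewrite !permKV.
  have := neq 1%N isT; have := neq 0 isT.
  rewrite (fix1 _ _ L1) // ta tb permKV => /(_ ac) + /(_ bc).
  by case: (nat_of_ord _) => [|[|k]].
exists (t2 * t1 * t0); last split.
- by rewrite !groupM // ?(subsetP (@level_sub 0 2 _) _ L2)
    ?(subsetP (@level_sub 0 1 _) _ L1).
- by rewrite !permM (fix1 _ _ L2) // (fix1 _ _ L1).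
- by rewrite !permM (fix1 _ _ L2) // tb permKV.
- by rewrite !permM tc !permKV.
Qed.

Lemma odd_cycp l : all (gtn 24) l -> uniq l -> odd_perm (cycp l) = odd (size l).-1.
Proof.
case: l => [|x l] /=; first by rewrite /cycp big_nil odd_perm1.
case/andP=> ltx ltl /andP[xl _]; rewrite /cycp /=.
elim: l ltl xl => [|y l IHl] /=; first by rewrite big_nil odd_perm1.
case/andP=> lty ltl; rewrite inE negb_or => /andP[xy xl].
rewrite big_cons odd_mul_tperm IHl //; suff ->: inord x != inord y :> 'I_24 by [].
by apply: contraNneq xy => /(congr1 val)/=; rewrite !inordK // => ->.
Qed.

(** The cycles of length 5 and 23 are even, and gamma has twelve 2-cycles. *)
Lemma M24_even s : s \in M24 -> ~~ odd_perm s.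
Proof.
suff /subsetP sub: M24 \subset 'Alt_('I_24) by move/sub; rewrite Alt_even.
rewrite gen_subG; apply/subsetP=> t; rewrite Alt_even !inE -orbA.
by case/or3P=> /eqP->; rewrite ?/M24_alpha ?/M24_gamma ?/M24_delta ?big_cons ?big_nil;
  rewrite ?odd_permM !odd_cycp ?odd_perm1.
Qed.

Definition prime_fix_table : seq (nat * nat) :=
  [:: (2, 0); (2, 8); (3, 0); (3, 6); (5, 4); (7, 3); (11, 2); (23, 1)]%N.

(** The number f of fixed points satisfies p | 24 - f.  For f <= 2 this leaves
    only one wrong case, p = 2 and f = 2, in which s would be a product of
    eleven transpositions, hence odd.  For f >= 3, a conjugate of s fixes 0, 1
    and 2, and belongs to a list of 20160 permutations. *)
Lemma M24_prime_fix s p : s \in M24 -> prime p -> #[s] = p ->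
  (p, nfix s) \in prime_fix_table.
Proof.
move=> sM p_pr os; have := nfix_mod p_pr os; rewrite card_ord => mod24.
have p1 := prime_gt1 p_pr.
have lt_f : nfix s < 24.
  have := @nfix_lt _ s; rewrite card_ord; apply.
  by apply: contraTneq p1 => s1; rewrite -os s1 order1.
have /= dvd24 : p %| 24 - nfix s by rewrite -eqn_mod_dvd ?(ltnW lt_f) //; apply/eqP.
have p_primes f : f = nfix s -> 0 < 24 - f -> p \in primes (24 - f).
  by move=> -> f0; rewrite mem_primes p_pr f0.
have [le_f2 | ] := leqP (nfix s) 2.
  move: (p_primes _ (erefl _)); rewrite subn_gt0 => /(_ lt_f).
  case def_f: (nfix s) le_f2 => [|[|[|f]]] // _.
  - by rewrite (_ : primes _ = [:: 2; 3]%N) // !inE => /orP[]/eqP->.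
  - by rewrite (_ : primes _ = [:: 23]%N) // !inE => /eqP->.
  rewrite (_ : primes _ = [:: 2; 11]%N) // !inE => /orP[]/eqP eq_p; rewrite eq_p //.
  by have:= M24_even sM; rewrite odd_involution ?os // card_ord def_f.
case/card_gt2P=> a [b [c [[]]]]; rewrite !inE => /eqP sa /eqP sb /eqP sc [ab bc ca].
have [|t t0 [ta tb tc]] := @level0_3trans a b c.
  by rewrite /= !inE negb_or ab bc eq_sym ca.
pose g := s ^ t^-1.
have g0 : g \in level 0 by rewrite groupJ ?groupV // (subsetP M24_level0).
have gfix x y : t x = y -> s y = y -> g x = x.
  by move=> <- sy; rewrite -[x](permK t) permJ sy permK.
have g3 : g \in level 3.
  have g1 : g \in level 1 by apply: (@level_stab 0 g (inord 0)); rewrite ?inordK ?(gfix _ _ ta).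
  have g2 : g \in level 2 by apply: (@level_stab 1 g (inord 1)); rewrite ?inordK ?(gfix _ _ tb).
  by apply: (@level_stab 2 g (inord 2)); rewrite ?inordK ?(gfix _ _ tc).
have := level3_fixpoint_ok g3; rewrite /fixpoint_ok -!code_mul -code_one !(inj_eq code_inj).
rewrite fixcount_code -/(nfix g) nfixJ.
have g_exp n : #[g] = n -> g ^+ n = 1 by move=> <-; apply: expg_order.
have og : #[g] = p by rewrite orderJ.
move: (p_primes _ (erefl _)); rewrite subn_gt0 => /(_ lt_f) + ok.
have g2 : #[g] = 2 -> g * g = 1 by move/g_exp; rewrite expgS expg1.
have g3' : #[g] = 3 -> g * g * g = 1 by move/g_exp; rewrite !expgS expg0 mulg1 mulgA.
case/or3P: ok => [||/andP[]]; rewrite ?inE.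
- case/orP=> /eqP f_s; last by rewrite f_s in lt_f.
  by rewrite f_s (_ : primes _ = [:: 2]%N) // !inE => /eqP->.
- case/andP=> /eqP-> gg; rewrite (_ : primes _ = [:: 3; 7]%N) // !inE.
  case/orP=> /eqP eq_p; rewrite eq_p // in og *.
  by rewrite g3' ?eqxx in gg.
case/orP=> /eqP-> gg.
  rewrite (_ : primes _ = [:: 2; 5]%N) // !inE.
  case/orP=> /eqP eq_p; rewrite eq_p // in og *.
  by rewrite g2 ?eqxx in gg.
rewrite (_ : primes _ = [:: 2; 3]%N) // !inE.
case/orP=> /eqP eq_p; rewrite eq_p // in og *.
by rewrite g2 ?eqxx in gg.
Qed.

(** * Elements of composite order in M24 *)
Definition code_has_order n l :=
  (iter n (codeM l) id24 == id24) &&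
  all (fun k => iter k (codeM l) id24 != id24) (iota 1 n.-1).

Lemma code_order s n : 0 < n -> code_has_order n (code s) -> #[s] = n.
Proof.
move=> n0 /andP[/eqP sn /allP lt_n]; apply/elt_orderE; split=> //.
  by apply: code_inj; rewrite code_exp code_one.
move=> k /andP[k0 ltkn] sk; have /lt_n: k \in iota 1 n.-1.
  by rewrite mem_iota k0 add1n prednK.
by rewrite -code_exp sk code_one eqxx.
Qed.

(** The letters 0, 1 and 2 stand for alpha, gamma and delta, any other letter
    for the identity. *)
Definition M24_word (w : seq nat) : 'S_24 :=
  \prod_(i <- w) nth 1 [:: M24_alpha; M24_gamma; M24_delta] i.

Lemma M24_word_mem w : M24_word w \in M24.
Proof.
rewrite /M24_word; elim: w => [|i w IHw]; first by rewrite big_nil.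
rewrite big_cons groupM //.
case: i => [|[|[|i]]] /=; rewrite ?nth_nil ?group1 // mem_gen //.
all: by rewrite !inE eqxx ?orbT.
Qed.

Lemma code_M24_word w : code (M24_word w) =
  foldr (fun i => codeM (nth id24 [:: code_alpha; code_gamma; code_delta] i))
        id24 w.
Proof.
elim: w => [|i w IHw]; first by rewrite /M24_word big_nil code_one.
rewrite /M24_word big_cons code_mul -/(M24_word w) IHw /=; congr codeM.
case: i => [|[|[|i]]] /=; rewrite ?nth_nil ?code_one //.
all: by rewrite ?code_M24_alpha ?code_M24_gamma ?code_M24_delta.
Qed.

Lemma M24_element_orders n : n \in [:: 6; 10; 14; 15; 21]%N ->
  exists2 s, s \in M24 & #[s] = n.
Proof.
have word_order w m : 0 < m -> code_has_order m (code (M24_word w)) ->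
    exists2 s, s \in M24 & #[s] = m.
  by move=> m0 wm; exists (M24_word w); [exact: M24_word_mem | exact: code_order].
rewrite !inE => /or4P[| | |/orP[]] /eqP->.
(* these words were found by enumeration in order of increasing length *)
- by apply: (word_order [:: 0; 2]%N) => //; rewrite code_M24_word; vm_compute.
- by apply: (word_order [:: 1; 2]%N) => //; rewrite code_M24_word; vm_compute.
- by apply: (word_order [:: 0; 0; 2; 2]%N) => //; rewrite code_M24_word; vm_compute.
- by apply: (word_order [:: 0; 0; 2; 0; 2; 2]%N) => //; rewrite code_M24_word; vm_compute.
by apply: (word_order [:: 0; 1; 2; 0; 2]%N) => //; rewrite code_M24_word; vm_compute.
Qed.

End Mathieu24.

Import Order.TTheory GRing.Theory Num.Theory.
Local Open Scope ring_scope.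

(** * Ranks of integral matrices *)
Section Rank.
Variable F : fieldType.

Lemma rank_diag_le n (d : 'rV[F]_n) :
  (\rank (diag_mx d) <= #|[pred i | (d 0 i != 0)%R]|)%N.
Proof.
rewrite diag_mx_sum_delta (bigID (fun i : 'I_n => d ord0 i == 0)) /= big1 ?add0r; last first.
  by move=> i /eqP->; rewrite scale0r.
rewrite -sum1_card; elim/big_ind2: _ => [|r A s B leA leB|i di].
- by rewrite mxrank0.
- exact: leq_trans (mxrank_add _ _) (leq_add leA leB).
by rewrite mxrank_scale_nz // mxrank_delta.
Qed.

(** The upper bound for the matrix, and for the diagonal matrix that completes it
    to an invertible one, force equality. *)
Lemma rank_diag n (d : 'rV[F]_n) :
  \rank (diag_mx d) = #|[pred i | (d 0 i != 0)%R]|.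
Proof.
apply/eqP; rewrite eqn_leq rank_diag_le /=.
pose e : 'rV[F]_n := \row_i (d 0 i == 0)%:R.
have unit_de: diag_mx (d + e) \in unitmx.
  rewrite unitmxE det_diag unitfE; apply/prodf_neq0=> i _; rewrite !mxE.
  by have [->|] := eqVneq (d 0 i) 0; rewrite ?add0r ?addr0 ?oner_eq0.
have: (n <= \rank (diag_mx d) + #|[pred i | (d 0 i == 0)%R]|)%N.
  rewrite -[X in (X <= _)%N](mxrank_unit unit_de) raddfD.
  apply: leq_trans (mxrank_add _ _) (leq_add (leqnn _) _).
  apply: leq_trans (rank_diag_le _) _; rewrite leq_eqVlt; apply/orP; left.
  apply/eqP/eq_card => i; rewrite !inE mxE.
  by case: (d 0 i == 0); rewrite ?oner_eq0 ?eqxx.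
rewrite -[X in (X <= _)%N](card_ord n) -(cardC [pred i | (d 0 i == 0)%R]).
by rewrite addnC leq_add2r.
Qed.

(** A minor that is nonzero in [F] comes from a nonzero integer, which remains
    nonzero in characteristic 0. *)
Lemma rank_int_le m n (A : 'M[int]_(m, n)) :
  (\rank (map_mx intr A : 'M[F]_(m, n)) <= \rank (map_mx intr A : 'M[algC]_(m, n)))%N.
Proof.
set B : 'M[F]_(m, n) := map_mx intr A; pose f := maxrankfun B.
have fullB: row_full (rowsub f B)^T.
  by rewrite /row_full mxrank_tr; apply: maxrowsub_free.
pose g := fullrankfun fullB.
have := fullrowsub_unit fullB; rewrite -/g => unitB.
set C : 'M[algC]_(m, n) := map_mx intr A.
have unitA : mxsub f g C \in unitmx.
  move: unitB; rewrite -unitmx_tr !unitmxE !unitfE.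
  have -> : (rowsub g (rowsub f B)^T)^T = map_mx intr (mxsub f g A).
    by apply/matrixP=> i j; rewrite !mxE.
  rewrite -map_mxsub !det_map_mx intr_eq0.
  by apply: contraNneq => ->.
have defA : mxsub f g C = rowsub f 1%:M *m C *m (rowsub g 1%:M)^T.
  by rewrite -rowsubE -[RHS]trmxK trmx_mul trmxK -rowsubE; apply/matrixP=> i j; rewrite !mxE.
rewrite -[X in (X <= _)%N](mxrank_unit unitA) defA.
exact: leq_trans (mxrankM_maxl _ _) (mxrankM_maxr _ _).
Qed.
End Rank.

(** * Eigenvalues of integral matrices of finite order *)
Section Spectrum.
Variable N : nat.
Implicit Types (A : 'M[int]_N.+1) (d : 'rV[algC]_N.+1).

Definition complex_mx A : 'M[algC]_N.+1 := map_mx intr A.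

(** [d] lists the eigenvalues of [A], with multiplicities, in the order of a
    basis of eigenvectors. *)
Definition spectrum A d : Prop :=
  exists2 P, P \in unitmx & complex_mx A = invmx P *m diag_mx d *m P.

Lemma spectrum_horner A d (p : {poly algC}) : spectrum A d ->
  exists2 P, P \in unitmx &
    horner_mx (complex_mx A) p = invmx P *m diag_mx (map_mx (horner p) d) *m P.
Proof.
by case=> P uP ->; exists P; rewrite // horner_mx_uconjC // horner_mx_diag.
Qed.

Lemma spectrum_trace A d (p : {poly algC}) : spectrum A d ->
  \tr (horner_mx (complex_mx A) p) = \sum_i p.[d 0 i].
Proof.
case/(spectrum_horner p) => P uP ->; rewrite mxtrace_mulC mulmxA mulmxV //.
by rewrite mul1mx mxtrace_diag; apply: eq_bigr => i _; rewrite mxE.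
Qed.

Lemma spectrum_rank A d (p : {poly algC}) : spectrum A d ->
  \rank (horner_mx (complex_mx A) p) = #|[pred i | p.[d 0 i] != 0]|.
Proof.
case/(spectrum_horner p) => P uP ->; rewrite mxrankMfree ?row_free_unit //.
rewrite -mxrank_tr trmx_mul mxrankMfree ?row_free_unit ?unitmx_tr ?unitmx_inv //.
by rewrite mxrank_tr rank_diag; apply: eq_card => i; rewrite !inE mxE.
Qed.

(** The minimal polynomial divides ['X^n - 1], whose roots are simple. *)
Lemma finite_order_spectrum A n : (0 < n)%N -> A ^+ n = 1 ->
  exists2 d, spectrum A d & forall i, d 0 i ^+ n = 1.
Proof.
move=> n_gt0 An; have [w prim_w] := C_prim_root_exists n_gt0.
have AnC : complex_mx A ^+ n = 1 by rewrite -rmorphXn /= An rmorph1.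
have [|P uP /diagonalizable_forPex[d /(simmxP uP) dP]] := (diagonalizableP (complex_mx A)).2.
  exists [seq w ^+ i | i <- index_iota 0 n].
    rewrite map_inj_in_uniq ?iota_uniq // => i j; rewrite !mem_index_iota /=.
    move=> lti ltj /eqP; rewrite (eq_prim_root_expr prim_w) !modn_small //.
    by move/eqP.
  rewrite big_map factor_Xn_sub_1 //; apply: mxminpoly_min.
  by rewrite rmorphB rmorph1 rmorphXn /= horner_mx_X AnC subrr.
have dA : spectrum A d.
  by exists P => //; rewrite -mulmxA -dP mulmxA mulVmx // mul1mx.
exists d => // i; have := spectrum_rank ('X^n - 1) dA.
rewrite rmorphB rmorph1 rmorphXn /= horner_mx_X AnC subrr mxrank0.
move/esym/card0_eq/(_ i); rewrite !inE hornerD hornerN hornerXn hornerC => /negbFE.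
by rewrite subr_eq0 => /eqP.
Qed.

Definition nmult d z := #|[pred i | d (0 : 'I_1) i == z]|.

(** Written as the dimension of an eigenspace, a multiplicity is visibly
    invariant under automorphisms of the field. *)
Lemma nmultE A d z : spectrum A d ->
  nmult d z = (N.+1 - \rank (complex_mx A - z%:M)%R)%N.
Proof.
move=> dA; have := spectrum_rank ('X - z%:P) dA.
rewrite rmorphB /= horner_mx_X horner_mx_C => ->.
rewrite -[X in (X - _)%N](card_ord N.+1) -(cardC [pred i | (d 0 i == z)%R]).
rewrite -[X in (_ - X)%N]addn0 -[X in (_ + X - _)%N]addn0.
set a := #|_|; set b := #|_|; set c := #|_|.
have -> : b = c by apply: eq_card => i; rewrite !inE !hornerE subr_eq0.
by rewrite !addn0 addnK; apply: eq_card => i; rewrite !inE.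
Qed.

Lemma nmult_aut A d (u : {rmorphism algC -> algC}) z : spectrum A d ->
  nmult d (u z) = nmult d z.
Proof.
move=> dA; rewrite !(nmultE _ dA) -[in RHS](mxrank_map u); congr (_ - \rank _)%N.
rewrite map_mxB map_scalar_mx /=; congr (_ - _).
by apply/matrixP=> i j; rewrite !mxE rmorph_int.
Qed.

(** Primitive roots of the same order are Galois conjugate. *)
Lemma nmult_prim A d n z w : spectrum A d ->
  n.-primitive_root z -> n.-primitive_root w -> nmult d z = nmult d w.
Proof.
move=> dA prim_z prim_w.
have [k def_w] := prim_rootP prim_z (prim_expr_order prim_w).
have co_k : coprime k n by rewrite -(prim_root_exp_coprime _ prim_z) -def_w.
have [u uz] := Qn_aut_exists co_k.
by rewrite def_w -uz ?(prim_expr_order prim_z) // (nmult_aut u z dA).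
Qed.

End Spectrum.

(** * Eigenvalue multiplicities for order pq *)
Lemma sum_powers_root (F : fieldType) (x : F) n : x ^+ n = 1 -> x != 1 ->
  \sum_(0 <= i < n) x ^+ i = 0.
Proof.
move=> xn x1; apply: (mulfI (x := x - 1)); first by rewrite subr_eq0.
by rewrite mulr0 big_mkord -subrX1 xn subrr.
Qed.

Lemma sum_dvd_nat (R : nmodType) (m q : nat) (G : nat -> R) : (0 < q)%N ->
  \sum_(0 <= j < m * q | (q %| j)%N) G j = \sum_(0 <= i < m) G (i * q)%N.
Proof.
move=> q_gt0; elim: m => [|m IHm]; first by rewrite mul0n !big_nil.
rewrite big_nat_recr //= -IHm (@big_cat_nat _ _ _ (m * q)) //=; last by rewrite leq_mul.
congr (_ + _); rewrite big_ltn_cond ?ltn_pmul2r // dvdn_mull //.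
rewrite big_nat_cond big1 ?addr0 // => j /andP[/andP[ltj jlt] /dvdnP[k def_j]].
by move: ltj jlt; rewrite def_j !ltn_pmul2r // => ltk; rewrite ltnS leqNgt ltk.
Qed.

Lemma sum_dvd_powers (R : comNzRingType) (m q : nat) (y x : R) : (0 < q)%N ->
  \sum_(0 <= j < m * q) (if (q %| j)%N then y else 0) * x ^+ j =
    y * \sum_(0 <= i < m) (x ^+ q) ^+ i.
Proof.
move=> q_gt0; rewrite mulr_sumr -(eq_bigr _ (fun i _ => congr1 _ (exprM x q i))).
under eq_bigr do rewrite mulnC.
rewrite -(sum_dvd_nat m (fun j => y * x ^+ j) q_gt0) [RHS]big_mkcond.
by apply: eq_bigr => j _; case: ifP; rewrite ?mul0r.
Qed.

Lemma gcdn_prime_mul r s j : prime r -> (s %| j)%N -> ~~ (r %| j)%N ->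
  gcdn j (r * s) = s.
Proof.
move=> r_pr /dvdnP[k ->] rk; rewrite -muln_gcdl; suff /eqP->: coprime k r.
  by rewrite mul1n.
by rewrite coprime_sym prime_coprime //; apply: contra rk => /dvdn_mulr->.
Qed.

Section PrimePair.
Variables (N p q : nat) (A : 'M[int]_N.+1).
Hypotheses (p_pr : prime p) (q_pr : prime q) (neq_pq : p != q).
Hypothesis A_pq : A ^+ (p * q) = 1.

Lemma spectrum_sum (d : 'rV[algC]_N.+1) n w (G : algC -> algC) :
  n.-primitive_root w -> (forall i, d 0 i ^+ n = 1) ->
  \sum_i G (d 0 i) = \sum_(0 <= j < n) (nmult d (w ^+ j))%:R * G (w ^+ j).
Proof.
move=> prim_w dn; pose ind i := sval (prim_rootP prim_w (dn i)).
have indP i : d 0 i = w ^+ ind i by rewrite /ind; case: prim_rootP.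
rewrite big_mkord (partition_big ind xpredT) //=; apply: eq_bigr => j _.
rewrite (eq_bigr (fun=> G (w ^+ j))) => [|i /eqP <-]; last by rewrite indP.
rewrite sumr_const mulr_natl; congr (_ *+ _); apply: eq_card => i.
rewrite !inE indP (eq_prim_root_expr prim_w) !modn_small //.
Qed.

(** The numbers a, b, c and d are the multiplicities, as eigenvalues of [A], of 1
    and of any primitive root of unity of order p, q and pq respectively.  The
    multiplicity of w ^+ j, for a primitive pq-th root w, depends only on which
    of p and q divide j; this turns the traces into combinations of geometric
    sums, each equal to 0 or to its number of terms. *)
Lemma pq_multiplicities : exists a b c d : nat,
  [/\ N.+1%:Z = a%:Z + (p%:Z - 1) * b%:Z + (q%:Z - 1) * c%:Z
                + (p%:Z - 1) * (q%:Z - 1) * d%:Z,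
      \tr A = a%:Z - b%:Z - c%:Z + d%:Z,
      \tr (A ^+ q) = a%:Z - b%:Z + (q%:Z - 1) * (c%:Z - d%:Z)
    & \tr (A ^+ p) = a%:Z + (p%:Z - 1) * (b%:Z - d%:Z) - c%:Z].
Proof.
have [p_gt0 q_gt0] := (prime_gt0 p_pr, prime_gt0 q_pr).
have pq_gt0: (0 < p * q)%N by rewrite muln_gt0 p_gt0.
have co_pq: coprime p q by rewrite prime_coprime // dvdn_prime2.
have [e eA e_pq] := finite_order_spectrum pq_gt0 A_pq.
have [w prim_w] := C_prim_root_exists pq_gt0.
pose a := nmult e 1; pose b := nmult e (w ^+ q); pose c := nmult e (w ^+ p).
pose d := nmult e w; exists a, b, c, d.
have prim_q : p.-primitive_root (w ^+ q).
  by have := exp_prim_root prim_w q; rewrite (gcdn_idPl (dvdn_mull p _)) // mulnK.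
have prim_p : q.-primitive_root (w ^+ p).
  by have := exp_prim_root prim_w p; rewrite (gcdn_idPl (dvdn_mulr q _)) // mulKn.
have multE j : (j < p * q)%N -> (nmult e (w ^+ j))%:R = d%:R
    + (if (q %| j)%N then b%:R - d%:R else 0)
    + (if (p %| j)%N then c%:R - d%:R else 0)
    + (if (p * q %| j)%N then a%:R - b%:R - c%:R + d%:R else 0) :> algC.
  move=> ltj; have := exp_prim_root prim_w j; rewrite Gauss_dvd //.
  have [qj|nqj] := boolP (q %| j)%N; have [pj|npj] /= := boolP (p %| j)%N.
  - have: (p * q %| j)%N by rewrite Gauss_dvd ?pj.
    by rewrite /dvdn modn_small // => /eqP-> _; rewrite expr0 -/a; ring.
  - rewrite gcdn_prime_mul // mulnK // => prim_j.
    by rewrite (nmult_prim eA prim_j prim_q) -/b; ring.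
  - rewrite mulnC gcdn_prime_mul // mulnK // => prim_j.
    by rewrite (nmult_prim eA prim_j prim_p) -/c; ring.
  have -> : gcdn j (p * q) = 1%N.
    by apply/eqP; rewrite -/(coprime _ _) coprimeMr ![coprime j _]coprime_sym !prime_coprime ?npj.
  by rewrite divn1 => prim_j; rewrite (nmult_prim eA prim_j prim_w) -/d; ring.
have trE k : (\tr (A ^+ k))%:~R = d%:R * \sum_(0 <= j < p * q) (w ^+ k) ^+ j
    + (b%:R - d%:R) * \sum_(0 <= j < p) (w ^+ (q * k)) ^+ j
    + (c%:R - d%:R) * \sum_(0 <= j < q) (w ^+ (p * k)) ^+ j
    + (a%:R - b%:R - c%:R + d%:R) :> algC.
  have -> : (\tr (A ^+ k))%:~R = \tr (complex_mx A ^+ k) :> algC.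
    by rewrite -rmorphXn /= trace_map_mx.
  have := spectrum_trace 'X^k eA; rewrite rmorphXn /= horner_mx_X => ->.
  have -> : \sum_i ('X^k).[e 0 i] =
      \sum_(0 <= j < p * q) (nmult e (w ^+ j))%:R * (w ^+ k) ^+ j.
    under eq_bigr do rewrite hornerXn.
    rewrite (spectrum_sum (fun z => z ^+ k) prim_w e_pq).
    by apply: eq_bigr => j _; rewrite exprAC.
  under [LHS]eq_big_nat => j /andP[_ ltj] do rewrite multE // !mulrDl.
  have sumE m r (y x : algC) : (0 < r)%N -> (m * r = p * q)%N ->
      \sum_(0 <= j < p * q) (if (r %| j)%N then y else 0) * x ^+ j =
        y * \sum_(0 <= i < m) (x ^+ r) ^+ i.
    by move=> r_gt0 <-; apply: sum_dvd_powers.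
  rewrite !big_split /= -mulr_sumr (sumE p q) // (sumE q p _ _ p_gt0 (mulnC q p)).
  rewrite (sumE 1%N (p * q)%N) ?mul1n // big_nat1 expr0 mulr1 -!exprM.
  by rewrite ![(k * _)%N]mulnC.
have geomE k m : (p * q %| k * m)%N ->
    \sum_(0 <= i < m) (w ^+ k) ^+ i = if (p * q %| k)%N then m%:R else 0.
  rewrite (prim_order_dvd prim_w) exprM (prim_order_dvd prim_w k) => /eqP wkm.
  case: eqVneq => [->|wk1]; last exact: sum_powers_root.
  under eq_bigr do rewrite expr1n.
  by rewrite sumr_const_nat subn0.
have [p1 q1] := (prime_gt1 p_pr, prime_gt1 q_pr).
have pNq : (p %| q)%N = false by rewrite dvdn_prime2 // (negPf neq_pq).
have qNp : (q %| p)%N = false by rewrite dvdn_prime2 // eq_sym (negPf neq_pq).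
have dvd k : (p * q %| k)%N = (p %| k)%N && (q %| k)%N by rewrite Gauss_dvd.
split; apply: (@intr_inj algC).
- have := trE 0%N; rewrite !geomE ?dvd ?dvdn0 ?expr0 ?mxtrace1 ?muln0 ?dvdn0 //=.
  rewrite rmorph_nat natrM -pmulrn => ->.
  by rewrite !(rmorphD, rmorphB, rmorphM, rmorphN, rmorph1) /= -!pmulrn; ring.
- have := trE 1%N; rewrite expr1 !muln1 !geomE;
    rewrite ?dvd ?Euclid_dvdM ?pNq ?qNp ?dvdn1 ?dvdnn ?orbT ?gtn_eqF //= => ->.
  by rewrite !(rmorphD, rmorphB, rmorphM, rmorphN, rmorph1) /= -!pmulrn; ring.
- have := trE q; rewrite !geomE;
    rewrite ?dvd ?Euclid_dvdM ?pNq ?qNp ?dvdnn ?orbT //= => ->.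
  by rewrite !(rmorphD, rmorphB, rmorphM, rmorphN, rmorph1) /= -!pmulrn; ring.
have := trE p; rewrite !geomE;
  rewrite ?dvd ?Euclid_dvdM ?pNq ?qNp ?dvdnn ?orbT //= => ->.
by rewrite !(rmorphD, rmorphB, rmorphM, rmorphN, rmorph1) /= -!pmulrn; ring.
Qed.
End PrimePair.

(** * Matrices with a free action modulo p *)

(** The differences r i - r i.+1 decrease, and the first q have the same sum as
    the last q among the n first ones: they are all equal. *)
Lemma convex_linear (r : nat -> nat) q n : (0 < q)%N -> (q + q <= n)%N ->
    (forall i, (r i.+1 + r i.+1 <= r i + r i.+2)%N) ->
    (r (n - q) + r q = r 0 + r n)%N ->
  forall i, (i <= n)%N -> (r 0 + i * r 1 = r i + i * r 0)%N.
Proof.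
move=> q0 qn conv eqr.
pose D i : int := (r i)%:Z - (r i.+1)%:Z.
have D1 i : (D i.+1 <= D i)%R by have := conv i; rewrite /D; lia.
have Dle i j : (i <= j)%N -> (D j <= D i)%R.
  elim: j => [|j IHj]; first by rewrite leqn0 => /eqP->.
  rewrite leq_eqVlt => /predU1P[-> //|]; rewrite ltnS => /IHj.
  exact: le_trans (D1 j).
have sumD i j : \sum_(0 <= l < j) D (i + l)%N = (r i)%:Z - (r (i + j)%N)%:Z.
  elim: j => [|j IHj]; first by rewrite big_nil addn0 subrr.
  by rewrite big_nat_recr //= IHj /D addnS; ring.
have eqS : \sum_(0 <= l < q) (D l - D (n - q + l)%N) = 0.
  rewrite sumrB sumD subnK ?(leq_trans (leq_addl q q)) //.
  have -> : \sum_(0 <= l < q) D l = (r 0%N)%:Z - (r q)%:Z.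
    by have := sumD 0%N q; rewrite add0n; under eq_bigr do rewrite add0n.
  by move: eqr; lia.
have eq0 l : (l < q)%N -> D l = D (n - q + l)%N.
  move=> ltl; have /eqP := eqS; rewrite big_mkord psumr_eq0 => [/allP|j _]; last first.
    by rewrite subr_ge0 Dle ?leq_addl.
  move/(_ (Ordinal ltl)); rewrite mem_index_enum => /(_ isT).
  by rewrite /= subr_eq0 => /eqP.
have Dlast : D n.-1 = D 0%N.
  have e0 := eq0 _ q0; have := eq0 q.-1; rewrite prednK // leqnn => /(_ isT).
  have -> : (n - q + q.-1)%N = n.-1 by lia.
  move=> <-; apply/eqP; rewrite eq_le Dle // e0 Dle //; lia.
elim=> [|i IHi] ltin; first by rewrite !mul0n.
have := IHi (ltnW ltin).
suff : D i = D 0%N by rewrite /D; lia.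
by apply/eqP; rewrite eq_le Dle // -Dlast Dle //; lia.
Qed.

(** Below, q = p ^ e and [B] has order dividing p q m.  The freeness hypothesis on
    B ^+ (q * m), whose p-th power is 1, says that its fixed vectors are norms.
    Since m = 1 modulo p, a sum over m powers of [B] is a projection. *)
Section FreeModP.
Variables (F : fieldType) (p : nat).
Hypothesis charFp : p \in [pchar F].

Let p_pr : prime p := pcharf_prime charFp.
Let p_gt0 : (0 < p)%N := prime_gt0 p_pr.

Lemma poly_X1_pchar j : ('X - 1) ^+ (p ^ j) = 'X^(p ^ j) - 1 :> {poly F}.
Proof.
have nat_pj : [pchar {poly F}].-nat (p ^ j)%N.
  rewrite (eq_pnat _ (@pchar_poly F)) pnatX orbC.
  by rewrite (pnatE _ p_pr) charFp orbT.
by apply: (addIr 1); rewrite subrK -[in RHS](subrK 1 'X) [RHS]exprDn_pchar // expr1n.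
Qed.

Lemma poly_norm_pchar j :
  \sum_(i < p) 'X^(p ^ j * i) = ('X - 1) ^+ (p ^ j * p.-1) :> {poly F}.
Proof.
have X1_neq0 : ('X - 1) ^+ (p ^ j) != 0 :> {poly F}.
  by rewrite expf_neq0 // -size_poly_eq0 size_XsubC.
apply: (mulfI X1_neq0); rewrite -exprD -mulnS prednK // -expnSr !poly_X1_pchar.
under eq_bigr do rewrite exprM.
by rewrite -subrX1 -exprM -expnSr.
Qed.

Variables (e m N : nat) (B : 'M[F]_N.+1).
Local Notation q := (p ^ e)%N.
Hypotheses (m1 : m = 1 %[mod p]) (B_order : B ^+ (p * q * m) = 1).
Hypothesis B_free : forall v : 'rV[F]_N.+1, v *m B ^+ (q * m) = v ->
  exists w, v = w *m \sum_(i < p) B ^+ (q * m * i).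

Local Notation X := (B - 1).

Lemma mx_X1_pchar j : X ^+ (p ^ j) = B ^+ (p ^ j) - 1.
Proof.
have /(congr1 (horner_mx B)) := poly_X1_pchar j.
by rewrite !(rmorphXn, rmorphB, rmorph1) /= !horner_mx_X.
Qed.

Lemma mx_norm_pchar j : \sum_(i < p) B ^+ (p ^ j * i) = X ^+ (p ^ j * p.-1).
Proof.
have /(congr1 (horner_mx B)) := poly_norm_pchar j.
rewrite !(rmorph_sum, rmorphXn, rmorphB, rmorph1) /= !horner_mx_X => <-.
by apply: eq_bigr => i _; rewrite rmorphXn /= horner_mx_X.
Qed.

Lemma fix_exp (v : 'rV[F]_N.+1) (C : 'M[F]_N.+1) k : v *m C = v -> v *m C ^+ k = v.
Proof.
by move=> vC; elim: k => [|k IHk]; rewrite ?expr0 ?mulmx1 // exprS mulmxA vC.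
Qed.

Lemma fix_avg (v : 'rV[F]_N.+1) (C : 'M[F]_N.+1) : v *m C = v ->
  v *m \sum_(l < m) C ^+ l = v.
Proof.
move=> vC; rewrite mulmx_sumr; under eq_bigr do rewrite fix_exp //.
rewrite sumr_const card_ord -scaler_nat; suff ->: m%:R = 1 :> F by rewrite scale1r.
by rewrite -(GRing.natr_mod_pchar charFp) m1 (GRing.natr_mod_pchar charFp).
Qed.

(** By freeness v is the norm of some w.  Projecting w to the vectors fixed by
    B ^+ (p * q) does not change its norm, as v is fixed; on these vectors
    B ^+ (q * m) acts as B ^+ q because m = 1 modulo p, and the norm of B ^+ q
    is a power of B - 1 in characteristic p. *)
Lemma fixed_is_norm (v : 'rV[F]_N.+1) : v *m X ^+ q = 0 ->
  exists w, v = w *m X ^+ (q * p.-1).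
Proof.
rewrite mx_X1_pchar mulmxBr mulmx1 => /eqP; rewrite subr_eq0 => /eqP vBq.
have vBqm : v *m B ^+ (q * m) = v by rewrite exprM fix_exp.
have [w def_v] := B_free vBqm.
pose E := \sum_(l < m) (B ^+ (q * p)) ^+ l.
have commE k : GRing.comm (B ^+ k) E.
  by apply: commr_sum => l _; rewrite -exprM; apply: commrX; apply/commr_sym/commrX.
have EB : E * B ^+ (q * p) = E.
  apply/eqP; rewrite -subr_eq0 -commE -[X in _ - X]mul1r -mulrBl -subrX1 -exprM.
  by rewrite [(q * p)%N]mulnC B_order subrr.
exists (w *m E); rewrite -mx_norm_pchar.
have -> : v = v *m E by rewrite fix_avg // exprM fix_exp.
rewrite {1}def_v -!mulmxA !mulmxE mulr_suml mulr_sumr; congr (w *m _).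
apply: eq_bigr => i _; rewrite commE.
have [t def_m] : exists t, m = (t * p).+1.
  have m_gt0 : (0 < m)%N.
    by case: (posnP m) m1 => // ->; rewrite mod0n modn_small ?prime_gt1.
  have /dvdnP[t def_t]: (p %| m - 1)%N by rewrite -eqn_mod_dvd // m1.
  by exists t; rewrite -def_t subn1 prednK.
have -> : (q * m * i = q * p * (t * i) + q * i)%N by rewrite def_m; ring.
rewrite exprD mulrA exprM; congr (_ * _).
by elim: (t * i)%N => [|k IHk]; rewrite ?mulr1 // exprS mulrA EB.
Qed.

(** On the vectors fixed by B ^+ (p * q), the nilpotent X = B - 1 has all its
    Jordan blocks of size p q.  Ranks of powers form a convex sequence, by the
    Frobenius inequality, and the inclusion of the kernel of X ^+ q in the
    image of X ^+ (p * q - q) says that the first q and the last q differences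
    of this sequence have the same sum. *)
Lemma rank_X1_linear i : (i <= p * q)%N ->
  (N.+1 + i * \rank X = \rank (X ^+ i) + i * N.+1)%N.
Proof.
move=> le_i; have q_gt0 : (0 < q)%N by rewrite expn_gt0 p_gt0.
have p_gt1 := prime_gt1 p_pr.
have lin := @convex_linear (fun i => \rank (X ^+ i)) q (p * q).
suff: (\rank (X ^+ 0) + i * \rank (X ^+ 1) =
       \rank (X ^+ i) + i * \rank (X ^+ 0))%N by rewrite expr0 expr1 mxrank1.
apply: lin => //.
- by rewrite addnn -mul2n leq_mul2r p_gt1 orbT.
- move=> j; have := mxrank_Frobenius X (X ^+ j) X.
  by rewrite !mulmxE -!exprS -!exprSr.
have -> : (p * q - q = q * p.-1)%N by rewrite -subn1 mulnBr muln1 mulnC.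
rewrite expr0 mxrank1.
have := mxrank_mul_ker (X ^+ (q * p.-1)) (X ^+ q).
have ker_sub : (kermx (X ^+ q) <= X ^+ (q * p.-1))%MS.
  apply/row_subP=> j; have [|w ->] := fixed_is_norm (v := row j (kermx (X ^+ q))).
    by rewrite -row_mul mulmx_ker row0.
  exact: submxMl.
rewrite (capmx_idPr ker_sub) mxrank_ker mulmxE -exprD -mulnSr prednK // [(q * p)%N]mulnC.
by have := rank_leq_row (X ^+ q); lia.
Qed.

End FreeModP.

Section FixedCount.
Variables (p e m N : nat) (B : 'M[int]_N.+1) (d : 'rV[algC]_N.+1).
Hypothesis p_pr : prime p.
Local Notation q := (p ^ e)%N.
Local Notation Bp := (map_mx intr B : 'M['F_p]_N.+1).
Hypotheses (m1 : m = 1 %[mod p]) (B_order : B ^+ (p * q * m) = 1).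
Hypothesis B_free : forall v : 'rV['F_p]_N.+1, v *m Bp ^+ (q * m) = v ->
  exists w, v = w *m \sum_(i < p) Bp ^+ (q * m * i).
Hypotheses (dB : spectrum B d) (d_order : forall i, d 0 i ^+ (p * q * m) = 1).

(** Reduction modulo p cannot increase the rank, and the rank over the complex
    numbers counts the eigenvalues that are not roots of [P]. *)
Lemma rank_horner_le (P : {poly int}) :
  (\rank (horner_mx Bp (map_poly intr P)) <=
   #|[pred i | ((map_poly intr P).[d 0 i] != 0)%R]|)%N.
Proof.
rewrite -map_horner_mx; apply: leq_trans (rank_int_le _ _) _.
by rewrite map_horner_mx (spectrum_rank _ dB).
Qed.

Definition nfixed k := #|[pred i | (d (0 : 'I_1) i ^+ k == 1)%R]|.

Lemma count_roots (P : pred 'I_N.+1) : (#|P| + #|[predC P]| = N.+1)%N.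
Proof. by rewrite cardC card_ord. Qed.

Let charFp : p \in [pchar 'F_p].
Proof. exact: pchar_Fp. Qed.
Let p_gt0 : (0 < p)%N := prime_gt0 p_pr.
Let BpX k : map_mx intr (B ^+ k) = Bp ^+ k.
Proof. by rewrite rmorphXn. Qed.
Let Bp_order : Bp ^+ (p * q * m) = 1.
Proof. by rewrite -BpX B_order rmorph1. Qed.

Let lin i := @rank_X1_linear 'F_p p charFp e m N Bp m1 Bp_order B_free i.

Lemma nfixed1_le : (nfixed 1 + \rank (Bp - 1)%R <= N.+1)%N.
Proof.
have := rank_horner_le ('X - 1).
rewrite !(rmorphB, rmorph1) /= !map_polyX horner_mx_X => le_r.
apply: leq_trans (leq_add (leqnn _) le_r) _.
have := count_roots [pred i | (d 0 i ^+ 1 == 1)%R]; rewrite -/(nfixed 1).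
set A := #|_|; set C := #|_|; suff -> : A = C by move=> ->.
by apply: eq_card => i; rewrite !inE expr1 !hornerE subr_eq0.
Qed.

(** The eigenvalues z with z ^+ (p ^ j.+1) = 1 and z ^+ (p ^ j) != 1 are roots of
    the polynomial 1 + Y + .. + Y ^+ p.-1 evaluated at Y = 'X^(p ^ j), which
    modulo p is a power of 'X - 1. *)
Lemma nfixedS_le j : (nfixed (p ^ j.+1) + \rank ((Bp - 1) ^+ (p ^ j * p.-1))%R <=
  N.+1 + nfixed (p ^ j))%N.
Proof.
pose P : {poly int} := \sum_(i < p) 'X^(p ^ j * i).
have hornerP z : (map_poly intr P).[z] = \sum_(i < p) (z ^+ (p ^ j)) ^+ i :> algC.
  rewrite rmorph_sum horner_sum; apply: eq_bigr => i _.
  by rewrite /= map_polyXn hornerXn exprM.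
have := rank_horner_le P; have -> : horner_mx Bp (map_poly intr P) = (Bp - 1) ^+ (p ^ j * p.-1).
  rewrite -(mx_norm_pchar charFp) !rmorph_sum /=; apply: eq_bigr => i _.
  by rewrite map_polyXn rmorphXn /= horner_mx_X.
set r := \rank _.
pose A := #|[pred i | ((map_poly intr P).[d 0 i] == 0)%R]|.
set C := #|_| => leC; have AC : (A + C = N.+1)%N.
  by have := count_roots [pred i | ((map_poly intr P).[d 0 i] == 0)%R].
suff : (nfixed (p ^ j.+1) <= A + nfixed (p ^ j))%N by lia.
rewrite /nfixed /A -(cardID [pred i | (d 0 i ^+ (p ^ j) == 1)%R]) addnC leq_add //.
  apply/subset_leq_card/subsetP=> i; rewrite !inE hornerP expnSr exprM.
  case/andP=> zj1; set t := d 0 i ^+ _ => /eqP tp.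
  have: (t - 1) * \sum_(i < p) t ^+ i == 0 by rewrite -subrX1 tp subrr.
  by rewrite mulf_eq0 subr_eq0 (negPf zj1).
by apply/subset_leq_card/subsetP=> i; rewrite !inE => /andP[].
Qed.

(** The sum of the first m powers of B ^+ (p * q) has a rank over the complex
    numbers equal to the number of eigenvalues with z ^+ (p * q) = 1, while
    modulo p its image contains all the vectors fixed by B ^+ (p * q). *)
Lemma nfixed_ge : (N.+1 <= nfixed (p * q) + \rank ((Bp - 1) ^+ (p * q)))%N.
Proof.
pose P : {poly int} := \sum_(l < m) 'X^(p * q * l).
have m_neq0 : (m%:R : algC) != 0.
  rewrite pnatr_eq0; case: eqP m1 => // ->.
  by rewrite mod0n modn_small ?prime_gt1.
have -> : nfixed (p * q) = #|[pred i | ((map_poly intr P).[d 0 i] != 0)%R]|.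
  apply: eq_card => i; rewrite !inE rmorph_sum horner_sum.
  under eq_bigr do rewrite /= map_polyXn hornerXn exprM.
  set t := d 0 i ^+ _; have tm : t ^+ m = 1 by rewrite -exprM d_order.
  have [->|t1] := eqVneq t 1.
    under eq_bigr do rewrite expr1n.
    by rewrite sumr_const card_ord m_neq0.
  have: (t - 1) * \sum_(i < m) t ^+ i == 0 by rewrite -subrX1 tm subrr.
  by rewrite mulf_eq0 subr_eq0 (negPf t1) /= => /eqP->; rewrite eqxx.
apply: leq_trans (leq_add (rank_horner_le P) (leqnn _)).
have := mxrank_ker ((Bp - 1) ^+ (p * q)).
suff ker_sub : (kermx ((Bp - 1) ^+ (p * q)) <= horner_mx Bp (map_poly intr P))%MS.
  by have := mxrankS ker_sub; have := rank_leq_row ((Bp - 1) ^+ (p * q)); lia.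
apply/row_subP=> j; set v := row j _.
have vB : v *m Bp ^+ (p * q) = v.
  have : v *m (Bp - 1) ^+ (p * q) = 0 by rewrite -row_mul mulmx_ker row0.
  rewrite -expnS (mx_X1_pchar charFp) mulmxBr mulmx1 => /eqP.
  by rewrite subr_eq0 => /eqP.
have <- : v *m horner_mx Bp (map_poly intr P) = v; last exact: submxMl.
rewrite -[RHS](fix_avg charFp m1 vB); congr (_ *m _).
rewrite !rmorph_sum /=; apply: eq_bigr => i _.
by rewrite map_polyXn rmorphXn /= horner_mx_X exprM.
Qed.

(** With T j = p ^ j * (N.+1 - rank (B - 1)), the bounds give at most T 0
    eigenvalues equal to 1, at most T j.+1 - T j new ones at each step, and at
    least T e.+1 at the end: all the bounds are attained. *)
Lemma nfixed_p : (p * nfixed 1 = nfixed p)%N.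
Proof.
have p_gt1 := prime_gt1 p_pr; pose r : nat := \rank (Bp - 1).
have le_r : (r <= N.+1)%N := rank_leq_row _.
pose T j := (p ^ j * (N.+1 - r))%N.
have TS j : T j.+1 = (p * T j)%N by rewrite /T expnS mulnA.
have rankT i : (i <= p * q)%N ->
    (\rank ((Bp - 1) ^+ i) + i * (N.+1 - r) = N.+1)%N.
  by move/lin=> eq_i; rewrite mulnBr addnBA ?leq_mul // -eq_i addnK.
have step j : (j <= e)%N -> (nfixed (p ^ j.+1) + T j <= nfixed (p ^ j) + T j.+1)%N.
  move=> leje; have le_i: (p ^ j * p.-1 <= p * q)%N.
    by rewrite mulnC leq_mul ?leq_pred // leq_pexp2l.
  have := nfixedS_le j; have := rankT _ le_i.
  have -> : (p ^ j * p.-1 * (N.+1 - r) = T j.+1 - T j)%N.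
    by rewrite TS -{2}[T j]mul1n -mulnBl subn1 /T mulnCA mulnA.
  have : (T j <= T j.+1)%N by rewrite TS leq_pmull.
  by move: (\rank _) (nfixed _) (nfixed _) (T j) (T j.+1) => c x y t t'; lia.
have up : (nfixed (p ^ 0) <= T 0)%N.
  by have := nfixed1_le; rewrite -/r /T expn0 mul1n; lia.
have low : (T e.+1 <= nfixed (p ^ e.+1))%N.
  by have := nfixed_ge; have := rankT _ (leqnn (p * q)); rewrite /T expnS; lia.
have lowj j : (j <= e.+1)%N -> (T (e.+1 - j) <= nfixed (p ^ (e.+1 - j)))%N.
  elim: j => [|j IHj] lej; first by rewrite subn0.
  have := IHj (ltnW lej); have := step (e.+1 - j.+1)%N.
  rewrite subSS leq_subr -subSn // => /(_ isT); lia.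
have := lowj e.+1 (leqnn _); have := lowj e (leqnSn _); have := step 0%N (leq0n e).
rewrite subnn subSnn TS expn0 expn1; move: up; rewrite expn0; nia.
Qed.
End FixedCount.

(** * Vanishing of the trace of a free action *)
Definition exp_row N (d : 'rV[algC]_N) k : 'rV[algC]_N := \row_i d 0 i ^+ k.

Lemma spectrum_exp N (A : 'M[int]_N.+1) d k :
  spectrum A d -> spectrum (A ^+ k) (exp_row d k).
Proof.
case/(spectrum_horner 'X^k) => P uP; rewrite rmorphXn /= horner_mx_X => eqA.
exists P; rewrite // /complex_mx rmorphXn /= eqA; congr (_ *m diag_mx _ *m _).
by apply/rowP=> i; rewrite !mxE hornerXn.
Qed.

Lemma sum_nmult_roots N (d : 'rV[algC]_N.+1) s z : s.-primitive_root z ->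
  (\sum_(j < s) nmult d (z ^+ j)%R = nfixed d s)%N.
Proof.
move=> prim_z; rewrite /nfixed -sum1_card.
pose ind i := odflt (Ordinal (prim_order_gt0 prim_z)) [pick j : 'I_s | d 0 i == z ^+ j].
rewrite (partition_big ind xpredT) //=; apply: eq_bigr => j _.
rewrite /nmult -sum1_card; apply: eq_bigl => i; rewrite !inE /ind; apply/esym.
apply/andP/eqP => [[/eqP/(prim_rootP prim_z)[k def_di]] | def_di].
  by case: pickP => [l /eqP-> /eqP<- // | /(_ k)]; rewrite def_di eqxx.
split; first by rewrite def_di exprAC (prim_expr_order prim_z) expr1n.
case: pickP => [l /= | /(_ j)]; rewrite def_di ?eqxx //.
by rewrite (eq_prim_root_expr prim_z) !modn_small // eq_sym.
Qed.

(** By induction on s: in the difference of the two sums the terms of order less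
    than s cancel, and those of order s are all equal. *)
Lemma root_sums_inj (f g : algC -> int) (P : pred nat) :
    (forall s t, (t %| s)%N -> P s -> P t) ->
    (forall s y z, P s -> s.-primitive_root y -> s.-primitive_root z -> f y = f z) ->
    (forall s y z, P s -> s.-primitive_root y -> s.-primitive_root z -> g y = g z) ->
    (forall s z, P s -> s.-primitive_root z ->
      \sum_(j < s) f (z ^+ j) = \sum_(j < s) g (z ^+ j)) ->
  forall s z, P s -> s.-primitive_root z -> f z = g z.
Proof.
move=> Pdvd fprim gprim eq_sum s; have [k] := ubnP s.
elim: k s => // k IHk s lesk z Ps prim_z.
have s_gt0 := prim_order_gt0 prim_z.
have := eq_sum s z Ps prim_z; apply: contra_eq => neq_fg.
rewrite -subr_eq0 -sumrB (bigID (fun j : 'I_s => coprime j s)) /= addrC big1 ?add0r.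
  rewrite (eq_bigr (fun=> f z - g z)) => [|j co_js].
    rewrite sumr_const mulrn_eq0 subr_eq0 (negPf neq_fg) orbF.
    rewrite -lt0n; apply/card_gt0P; exists (Ordinal (ltn_pmod 1 s_gt0)).
    by rewrite -[_ \in _]/(coprime (1 %% s) s) coprime_modl coprime1n.
  have prim_zj : s.-primitive_root (z ^+ j) by rewrite prim_root_exp_coprime.
  by rewrite (fprim s (z ^+ j) z) // (gprim s (z ^+ j) z).
move=> j nco_js; have prim_zj := exp_prim_root prim_z j.
rewrite (IHk (s %/ gcdn j s)%N) ?subrr //; last first.
  by apply: Pdvd Ps; apply: dvdn_div; apply: dvdn_gcdr.
rewrite ltnS in lesk; apply: leq_trans lesk; rewrite ltn_Pdiv //.
by rewrite ltn_neqAle eq_sym nco_js gcdn_gt0 s_gt0 orbT.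
Qed.

Lemma prim_root_neq0 (F : fieldType) s (t : F) : s.-primitive_root t -> t != 0.
Proof.
move=> prim_t; apply/eqP=> t0; have := prim_expr_order prim_t.
rewrite t0 expr0n gtn_eqF ?(prim_order_gt0 prim_t) // => /eqP.
by rewrite eq_sym oner_eq0.
Qed.

(** The previous results apply to the powers [A ^+ s] for s prime to p; together
    they say that the multiplicities of the eigenvalues of [A] are invariant
    under multiplication by a primitive p-th root of unity. *)
Section TraceZero.
Variables (p e m N : nat) (A : 'M[int]_N.+1).
Hypothesis p_pr : prime p.
Local Notation n := (p * p ^ e * m)%N.
Local Notation Ap := (map_mx intr A : 'M['F_p]_N.+1).
Hypotheses (m1 : m = 1 %[mod p]) (A_order : A ^+ n = 1).
Hypothesis A_free : forall j, coprime j p ->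
  forall v : 'rV['F_p]_N.+1, v *m Ap ^+ (p ^ e * m * j) = v ->
  exists w, v = w *m \sum_(i < p) Ap ^+ (p ^ e * m * j * i).

Let p_gt0 : (0 < p)%N := prime_gt0 p_pr.
Let p_gt1 : (1 < p)%N := prime_gt1 p_pr.

Lemma n_gt0 : (0 < n)%N.
Proof.
rewrite !muln_gt0 expn_gt0 p_gt0 /=; case: posnP m1 => // ->.
by rewrite mod0n modn_small.
Qed.

Variable d : 'rV[algC]_N.+1.
Hypotheses (dA : spectrum A d) (d_order : forall i, d 0 i ^+ n = 1).

Lemma nfixed_mulp s : coprime s p -> (p * nfixed d s = nfixed d (p * s))%N.
Proof.
move=> co_sp; have nfixE k : nfixed (exp_row d s) k = nfixed d (k * s).
  by apply: eq_card => i; rewrite !inE mxE -exprM mulnC.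
have := @nfixed_p p e m N (A ^+ s) (exp_row d s) p_pr m1.
rewrite !nfixE mul1n; apply.
- by rewrite exprAC A_order expr1n.
- move=> v; rewrite !rmorphXn /= -!exprM [(s * _)%N]mulnC => /(A_free co_sp)[w ->].
  exists w; congr (_ *m _); apply: eq_bigr => i _.
  by rewrite -exprM mulnCA !mulnA.
- exact: spectrum_exp.
by move=> i; rewrite mxE exprAC d_order expr1n.
Qed.

(** Both sides depend only on the order of z, and have the same sum over each
    group of roots of unity of order prime to p. *)
Lemma nmult_expp s z : coprime s p -> s.-primitive_root z ->
  (nmult (exp_row d p) z = p * nmult d z)%N.
Proof.
move=> co_sp prim_z; pose f y : int := (nmult (exp_row d p) y)%:Z.
pose g y : int := (p * nmult d y)%N%:Z.
apply/eqP; rewrite -eqz_nat -/(f z) -/(g z); apply/eqP.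
apply: (@root_sums_inj f g (fun s => coprime s p)) co_sp prim_z.
- by move=> {}s t ts; apply: coprime_dvdl.
- move=> {}s y {}z _ prim_y prim_z.
  by rewrite /f (nmult_prim (spectrum_exp p dA) prim_y prim_z).
- by move=> {}s y {}z _ prim_y prim_z; rewrite /g (nmult_prim dA prim_y prim_z).
move=> {}s {}z co_sp prim_z.
rewrite -!(big_morph Posz PoszD (erefl _)) -big_distrr /= !sum_nmult_roots //.
rewrite nfixed_mulp //.
by congr Posz; apply: eq_card => i; rewrite !inE mxE -exprM.
Qed.

Variable w : algC.
Hypothesis prim_w : p.-primitive_root w.

Lemma nmult_fiber t : t != 0 ->
  (nmult (exp_row d p) (t ^+ p)%R = \sum_(l < p) nmult d (t * w ^+ l)%R)%N.
Proof.
move=> t0; rewrite {1}/nmult -sum1_card.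
pose ind i := odflt (Ordinal p_gt0) [pick l : 'I_p | d 0 i == t * w ^+ l].
rewrite (partition_big ind xpredT) //=; apply: eq_bigr => l _.
rewrite /nmult -sum1_card; apply: eq_bigl => i; rewrite !inE mxE /ind.
apply/andP/eqP => [[/eqP def_dp] | def_di].
  have /(prim_rootP prim_w)[k def_k]: (d 0 i / t) ^+ p = 1.
    by rewrite expr_div_n def_dp divff // expf_neq0.
  case: pickP => [j /eqP-> /eqP<- // | /(_ k)].
  by rewrite -def_k mulrC divfK // eqxx.
split; first by rewrite def_di exprMn exprAC (prim_expr_order prim_w) expr1n mulr1.
case: pickP => [j /= | /(_ l)]; rewrite def_di ?eqxx // (inj_eq (mulfI t0)).
by rewrite (eq_prim_root_expr prim_w) !modn_small // eq_sym.
Qed.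

(** For l prime to p, the roots t * w ^+ l are conjugate, so that the fibre of the
    p-th power map above t ^+ p contributes one multiplicity for t and p - 1
    equal ones; by nmult_expp their sum is p times the first. *)
Lemma nmult_twist s t l : coprime s p -> s.-primitive_root t ->
  nmult d (t * w ^+ l) = nmult d t.
Proof.
move=> co_sp prim_t; have s_gt0 := prim_order_gt0 prim_t.
have [pl|npl] := boolP (p %| l)%N.
  by rewrite -(divnK pl) mulnC exprM (prim_expr_order prim_w) expr1n mulr1.
have twist k : ~~ (p %| k)%N -> nmult d (t * w ^+ k) = nmult d (t * w).
  (* the automorphism z |-> z ^+ c fixes t and maps w to w ^+ k *)
  move=> npk; pose c := chinese s p 1 k.
  have c_s : c = 1 %[mod s] by apply: chinese_modl.
  have c_p : c = k %[mod p] by apply: chinese_modr.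
  have co_c : coprime c (s * p).
    rewrite coprimeMr -(coprime_modl c s) c_s coprime_modl coprime1n /=.
    by rewrite -coprime_modl c_p coprime_modl coprime_sym prime_coprime.
  have [u uz] := Qn_aut_exists co_c; rewrite -(nmult_aut u (t * w) dA) uz.
    rewrite exprMn; congr (nmult d (_ * _)).
      by apply/eqP; rewrite -[t in t == _]expr1 (eq_prim_root_expr prim_t) c_s.
    by apply/eqP; rewrite (eq_prim_root_expr prim_w) c_p.
  rewrite exprMn exprM (prim_expr_order prim_t) expr1n mul1r mulnC exprM.
  by rewrite (prim_expr_order prim_w) expr1n.
have prim_tp : s.-primitive_root (t ^+ p) by rewrite prim_root_exp_coprime 1?coprime_sym.
have t0 := prim_root_neq0 prim_t.
rewrite twist //; have := nmult_expp co_sp prim_tp.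
rewrite (nmult_prim dA prim_tp prim_t) nmult_fiber // (bigD1 (Ordinal p_gt0)) //=.
rewrite expr0 mulr1 (eq_bigr (fun=> nmult d (t * w))) => [|k k0].
  rewrite sum_nat_const cardC1 card_ord.
  have -> : (p * nmult d t = nmult d t + p.-1 * nmult d t)%N.
    by rewrite -mulSn prednK.
  move/addnI/eqP; rewrite eqn_pmul2l -?subn1 ?subn_gt0 // => /eqP //.
apply: twist; apply: contra k0; rewrite -val_eqE /= => /dvdnP[c def_k].
by have := ltn_ord k; rewrite def_k; case: c {def_k} => // c; rewrite mulSn ltnNge leq_addr.
Qed.

(** Let s be the order of z ^+ p.  If p divides s, then z and w * z both have
    order s * p.  Otherwise z and w * z are multiples by powers of w of the
    same root of unity of order s. *)
Lemma nmult_mulw z : z ^+ n = 1 -> nmult d (w * z) = nmult d z.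
Proof.
move=> zn; pose y := z ^+ p.
have yn : y ^+ n = 1 by rewrite /y exprAC zn expr1n.
have [s prim_y sn] := prim_order_exists n_gt0 yn.
have wzp : (w * z) ^+ p = y by rewrite exprMn (prim_expr_order prim_w) mul1r.
have order_zp x : x ^+ n = 1 -> x ^+ p = y -> (p %| s)%N -> (s * p).-primitive_root x.
  move=> xn xp ps; have [o prim_x on] := prim_order_exists n_gt0 xn.
  have := exp_prim_root prim_x p; rewrite xp => prim_y'.
  have so : (s = o %/ gcdn p o)%N.
    apply/eqP; rewrite eqn_dvd.
    by rewrite (prim_order_dvd prim_y) (prim_expr_order prim_y') eqxx
               (prim_order_dvd prim_y') (prim_expr_order prim_y) eqxx.
  have po : (p %| o)%N.
    by apply: dvdn_trans ps _; rewrite so dvdn_div // dvdn_gcdr.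
  by rewrite so (gcdn_idPl po) divnK.
have [ps|nps] := boolP (p %| s)%N.
  apply: (nmult_prim dA (order_zp _ _ wzp ps) (order_zp _ zn _ ps)) => //.
  by rewrite exprMn zn mulr1 -!mulnA exprM (prim_expr_order prim_w) expr1n.
have co_sp : coprime s p by rewrite coprime_sym prime_coprime.
(* a p-th root of y of the same order as y *)
have [r co_rs rp] : exists2 r, coprime r s & y ^+ (r * p) = y.
  pose c := chinese s p 1 0.
  have pc : (p %| c)%N by rewrite /dvdn /c chinese_modr // mod0n.
  have c_s : c = 1 %[mod s] by apply: chinese_modl.
  exists (c %/ p)%N; last first.
    apply/eqP; rewrite divnK // -[y in _ == y]expr1.
    by rewrite (eq_prim_root_expr prim_y) c_s.
  apply: (@coprime_dvdl _ c); first by rewrite -{2}(divnK pc) dvdn_mulr.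
  by rewrite -coprime_modl c_s coprime_modl coprime1n.
pose t := y ^+ r; have prim_t : s.-primitive_root t by rewrite prim_root_exp_coprime.
have t0 := prim_root_neq0 prim_t.
have [l def_l] : {l : 'I_p | z / t = w ^+ l}.
  apply: (prim_rootP prim_w); rewrite expr_div_n -/y /t -exprM rp divff //.
  exact: prim_root_neq0 prim_y.
have -> : z = t * w ^+ l by rewrite -def_l mulrC divfK.
by rewrite mulrCA -exprS !(nmult_twist _ co_sp prim_t).
Qed.

(** Multiplication by w permutes the list of eigenvalues, hence preserves their
    sum. *)
Lemma trace_zero : \tr A = 0.
Proof.
pose D := [seq d 0 i | i <- enum 'I_N.+1].
have trE : (\tr A)%:~R = \sum_(z <- D) z :> algC.
  rewrite /D big_map big_enum /= -trace_map_mx.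
  have := spectrum_trace 'X dA; rewrite horner_mx_X => ->.
  by apply: eq_bigr => i _; rewrite hornerX.
have countD z : count_mem z D = nmult d z.
  rewrite /D count_map /nmult cardE size_filter enumT.
  by apply: eq_count => i; rewrite /= !inE.
have w0 := prim_root_neq0 prim_w.
have permD : perm_eq D [seq w * z | z <- D].
  apply/allP=> z Dz; have zn : z ^+ n = 1.
    move: Dz; rewrite mem_cat => /orP[/mapP[i _ ->] // | /mapP[_ /mapP[i _ ->] ->]].
    by rewrite exprMn d_order mulr1 -mulnA exprM (prim_expr_order prim_w) expr1n.
  have zwn : (z / w) ^+ n = 1.
    by rewrite expr_div_n zn -mulnA exprM (prim_expr_order prim_w) expr1n divr1.
  rewrite /= countD count_map -[in nmult d z](divfK w0 z) mulrC nmult_mulw //.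
  rewrite -countD; apply/eqP/eq_count => x /=.
  by rewrite -(inj_eq (mulfI w0) x) [w * (_ / _)]mulrC divfK.
apply: (@intr_inj algC); rewrite trE; apply/eqP.
have : (1 - w) * \sum_(z <- D) z == 0.
  by rewrite mulrBl mul1r mulr_sumr {1}(perm_big _ permD) big_map subrr.
rewrite mulf_eq0 subr_eq0 eq_sym; case: eqP => // w1.
by have := prim_order_dvd prim_w 1; rewrite expr1 w1 eqxx dvdn1 gtn_eqF.
Qed.
End TraceZero.

Lemma free_trace_zero p e m N (A : 'M[int]_N.+1) :
    prime p -> m = 1 %[mod p] -> A ^+ (p * p ^ e * m) = 1 ->
    (forall j, coprime j p -> forall v : 'rV['F_p]_N.+1,
      v *m map_mx intr A ^+ (p ^ e * m * j) = v ->
      exists w, v = w *m \sum_(i < p) map_mx intr A ^+ (p ^ e * m * j * i)) ->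
  \tr A = 0.
Proof.
move=> p_pr m1 A_order A_free.
have [d dA d_order] := finite_order_spectrum (n_gt0 e p_pr m1) A_order.
have [w prim_w] := C_prim_root_exists (prime_gt0 p_pr).
exact: trace_zero A_order A_free _ dA d_order _ prim_w.
Qed.

(** * Partial augmentations of torsion units *)
Lemma ord_enumeration (T : finType) (t : T) :
  {N : nat & {e : 'I_N.+1 -> T | bijective e & N.+1 = #|T|}}.
Proof.
have cardT : #|T|.-1.+1 = #|T| by rewrite prednK //; apply/card_gt0P; exists t.
exists #|T|.-1; exists (fun i => enum_val (cast_ord cardT i)) => //.
exists (fun x => cast_ord (esym cardT) (enum_rank x)) => [i|x].
  by rewrite enum_valK cast_ordK.
by rewrite cast_ordKV enum_rankK.
Qed.

Section Regular.
Variables (gT : finGroupType) (N : nat) (e : 'I_N.+1 -> gT).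
Hypothesis e_bij : bijective e.
Implicit Types (x y : gT) (u v : group_alg int gT).

(** The matrix of m |-> x^-1 m u on the group ring, acting on row vectors in the
    basis e. *)
Definition twisted_mx x u : 'M[int]_N.+1 :=
  \matrix_(i, j) u ((e i)^-1 * x * e j)%g.

Lemma twisted_mxM x y u v :
  twisted_mx x u * twisted_mx y v = twisted_mx (x * y)%g (u * v).
Proof.
apply/matrixP=> i j; rewrite !mxE [RHS]ffunE.
rewrite [RHS](reindex (fun l => ((e i)^-1 * x * e l)%g)) /=; last first.
  have [f eK fK] := e_bij; exists (fun h => f (x^-1 * e i * h)%g) => [l _|h _].
    by rewrite !mulgA mulgK mulVg mul1g eK.
  by rewrite fK !mulgA mulgK mulVg mul1g.
apply: eq_bigr => l _; rewrite !mxE; congr (_ * v _).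
by rewrite !invMg invgK !mulgA mulgK mulgKV.
Qed.

Lemma twisted_mx1 : twisted_mx 1%g 1 = 1.
Proof.
apply/matrixP=> i j; rewrite !mxE ffunE mulg1 -eq_mulVg1.
by rewrite (inj_eq (bij_inj e_bij)); case: (i == j).
Qed.

Lemma twisted_mxX x u k : twisted_mx x u ^+ k = twisted_mx (x ^+ k)%g (u ^+ k).
Proof.
elim: k => [|k IHk]; first by rewrite !expr0 expg0 twisted_mx1.
by rewrite !exprS expgS IHk twisted_mxM.
Qed.

Lemma twisted_mx_trace x u :
  \tr (twisted_mx x u) = \sum_h u (h^-1 * x * h)%g.
Proof.
rewrite [RHS](reindex e) /=; last exact: onW_bij.
by apply: eq_bigr => i _; rewrite mxE.
Qed.

(** Left multiplication by z permutes the basis without fixed points. *)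
Lemma twisted_mx_free p z (v : 'rV['F_p]_N.+1) : prime p -> #[z]%g = p ->
    v *m map_mx intr (twisted_mx z 1) = v ->
  exists w, v = w *m \sum_(i < p) map_mx intr (twisted_mx (z ^+ i)%g 1).
Proof.
move=> p_pr oz vz; have [f eK fK] := e_bij.
have mulE (y : gT) (w : 'rV['F_p]_N.+1) j :
    (w *m map_mx intr (twisted_mx y 1)) 0 j = w 0 (f (y * e j)%g).
  rewrite mxE (bigD1 (f (y * e j)%g)) //= !mxE ffunE fK.
  rewrite -mulgA mulVg eqxx mulr1 big1 ?addr0 // => i ne_i.
  rewrite !mxE ffunE -mulgA -eq_mulVg1; case: eqP => [ei | _]; last exact: mulr0.
  by case/eqP: ne_i; rewrite -ei eK.
have v_inv k j : v 0 (f (z ^+ k * e j)%g) = v 0 j.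
  elim: k => [|k IHk]; first by rewrite expg0 mul1g eK.
  have /matrixP/(_ 0 (f (z ^+ k * e j)%g)) := vz.
  by rewrite mulE fK mulgA -expgS IHk.
(* a vector constant on the right cosets of <z> is the norm of its restriction
   to a transversal *)
exists (\row_i (if e i == repr (<[z]> :* e i)%g then v 0 i else 0)).
apply/rowP=> j; rewrite mulmx_sumr summxE.
under eq_bigr do rewrite mulE mxE fK v_inv.
have /rcosetP[y /cycleP[k def_y] def_r]: repr (<[z]> :* e j)%g \in (<[z]> :* e j)%g.
  by rewrite mem_repr_rcoset.
have ltk : (k %% p < p)%N by rewrite ltn_mod prime_gt0.
have repE (i : nat) : ((z ^+ i * e j)%g == repr (<[z]> :* (z ^+ i * e j))%g)
    = (i == k %[mod p]).
  rewrite rcosetM rcoset_id ?mem_cycle // def_r def_y (inj_eq (mulIg _)).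
  by rewrite eq_expg_mod_order oz.
rewrite (bigD1 (Ordinal ltk)) //= repE modn_mod eqxx big1 ?addr0 // => i ne_i.
rewrite repE modn_small //; case: eqP => // eq_i; case/eqP: ne_i.
exact: val_inj.
Qed.

End Regular.

Section PartialAugmentations.
Variable gT : finGroupType.
Implicit Types (x g h : gT) (u v : group_alg int gT).

(** Hertweck's theorem.  Some prime p has a greater exponent in the order of x
    than in n.  A multiple of n with the exponent of p unchanged then gives a
    power of the twisted matrix in which u disappears, and x becomes an element
    of order p, so that the action is free modulo p and the trace vanishes. *)
Theorem conj_sum_eq0 u n x : (0 < n)%N -> u ^+ n = 1 -> ~~ (#[x]%g %| n)%N ->
  \sum_h u (h^-1 * x * h)%g = 0.
Proof.
move=> n_gt0 un; set o := #[x]%g => o_n.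
have o_gt0 : (0 < o)%N := order_gt0 x.
have [p p_pr lt_n] : exists2 p, prime p & (logn p n < logn p o)%N.
  have: ~~ all (fun p : nat => o`_p %| n)%N (primes o).
    apply: contra o_n => /allP part_n; apply/(dvdn_partP _ o_gt0) => p p_o.
    exact: part_n.
  case/allPn=> p; rewrite mem_primes => /and3P[p_pr _ _].
  by rewrite p_part pfactor_dvdn // -ltnNge; exists p.
have p_gt0 := prime_gt0 p_pr.
pose k := (logn p o).-1; have def_k : (logn p o = k.+1)%N.
  by rewrite prednK // (leq_ltn_trans _ lt_n).
(* by Fermat, a power of exponent p - 1 is 1 modulo p *)
pose m0 := (o`_p^' * n`_p^')%N; pose m := (m0 ^ p.-1)%N.
have co_m0 : coprime m0 p.
  by rewrite coprimeMl !(coprime_sym _ p) !prime_coprime // -!p'natE // !part_pnat.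
have m1 : m = 1 %[mod p].
  by rewrite /m -(totient_prime p_pr) Euler_exp_totient.
have dvd_m t : (t %| m0)%N -> (t %| m)%N.
  by apply: dvdn_exp; rewrite -subn1 subn_gt0 prime_gt1.
have n_qm : (n %| p ^ k * m)%N.
  rewrite -(partnC p n_gt0) p_part dvdn_mul ?dvd_m ?dvdn_mull //.
  by rewrite dvdn_exp2l // -ltnS -def_k.
have o_pqm : (o %| p * p ^ k * m)%N.
  rewrite -(partnC p o_gt0) p_part def_k expnS dvdn_mul ?dvd_m //.
  by rewrite dvdn_mulr.
have o_qm j : coprime j p -> ~~ (o %| p ^ k * m * j)%N.
  move=> co_jp; apply: contraL lt_n => o_qm; rewrite -leqNgt.
  have : (p ^ k.+1 %| p ^ k * (m * j))%N.
    by rewrite mulnA; apply: dvdn_trans o_qm; rewrite pfactor_dvdn ?def_k.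
  rewrite Gauss_dvdl; first by rewrite dvdn_Pexp2l ?prime_gt1 // ltnn.
  by rewrite coprimeXl // coprimeMr ![coprime p _]coprime_sym co_jp coprimeXl.
have [N [e e_bij _]] := ord_enumeration x.
have uX j : (n %| j)%N -> u ^+ j = 1.
  by case/dvdnP=> t ->; rewrite mulnC exprM un expr1n.
have uXj j : u ^+ (p ^ k * m * j) = 1.
  by apply: uX; apply: dvdn_mulr.
rewrite -(twisted_mx_trace e_bij); apply: (@free_trace_zero p k m) => //.
  rewrite (twisted_mxX e_bij) uX; last by rewrite -mulnA dvdn_mull.
  by have := o_pqm; rewrite order_dvdn => /eqP->; rewrite twisted_mx1.
move=> j co_jp v; set z := (x ^+ (p ^ k * m * j))%g.
have oz : #[z]%g = p.
  apply: nt_prime_order => //; last by rewrite -order_dvdn o_qm.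
  apply/eqP; rewrite -expgM -order_dvdn; apply: dvdn_trans o_pqm _.
  by rewrite [X in (_ %| X)%N]mulnC !mulnA dvdn_mulr.
rewrite -rmorphXn /= (twisted_mxX e_bij) uXj => /(twisted_mx_free e_bij p_pr oz)[w ->].
exists w; congr (_ *m _); apply: eq_bigr => i _.
by rewrite -rmorphXn /= (twisted_mxX e_bij) -mulnA uXj mulnA expgM.
Qed.
End PartialAugmentations.

Section ClassFunctions.
Variable gT : finGroupType.
Implicit Types (x g h : gT) (u v : group_alg int gT) (f : gT -> int).

Definition extend f u : int := \sum_g u g * f g.

Definition class_fun f := forall g h, f (g ^ h)%g = f g.

(** Averaging over conjugation replaces each u g by the coefficient sum over the
    class of g. *)
Lemma extend_eq0 u n f : (0 < n)%N -> u ^+ n = 1 -> class_fun f ->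
  (forall g, (#[g]%g %| n)%N -> f g = 0) -> extend f u = 0.
Proof.
move=> n_gt0 un f_class f0; have card_neq0 : #|gT|%:Z != 0.
  by rewrite eqz_nat -lt0n; apply/card_gt0P; exists 1%g.
apply: (mulfI card_neq0); rewrite mulr0.
have -> : #|gT|%:Z * extend f u = \sum_(h : gT) \sum_g f g * u (h^-1 * g * h)%g.
  rewrite -natz mulr_natl -sumr_const; apply: eq_bigr => h _.
  rewrite /extend (reindex_inj (conjg_inj h)); apply: eq_bigr => g _.
  by rewrite mulrC f_class conjgE mulgA.
rewrite exchange_big big1 // => g _; rewrite -mulr_sumr.
have [/f0-> | o_n] := boolP (#[g]%g %| n)%N; first by rewrite mul0r.
by rewrite (conj_sum_eq0 n_gt0 un o_n) mulr0.
Qed.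

(** The trace of multiplication by u is #|gT| times u 1, and a sum of #|gT| roots
    of unity.  If u 1 is nonzero, these roots of unity are equal, so that u is a
    multiple of 1. *)
Lemma berman_higman u n : (0 < n)%N -> u ^+ n = 1 -> augmentation u = 1 ->
  u != 1 -> u 1%g = 0.
Proof.
move=> n_gt0 un aug_u u1; have [N [e e_bij cardN]] := ord_enumeration (1%g : gT).
pose A := twisted_mx e 1%g u.
have An : A ^+ n = 1 by rewrite (twisted_mxX e_bij) un expg1n twisted_mx1.
have [d dA d_order] := finite_order_spectrum n_gt0 An.
have trA : \tr A = N.+1%:Z * u 1%g.
  rewrite (twisted_mx_trace e_bij) cardN -natz mulr_natl -sumr_const.
  by apply: eq_bigr => h _; rewrite mulg1 mulVg.
have trC : \sum_i d 0 i = (\tr A)%:~R :> algC.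
  have := spectrum_trace 'X dA; rewrite horner_mx_X trace_map_mx => ->.
  by apply: eq_bigr => i _; rewrite hornerX.
have norm_d i : `|d 0 i| = 1.
  by apply/eqP; rewrite -(pexpr_eq1 n_gt0) // -normrX d_order normr1.
apply: contraNeq u1 => u1_neq0; have : `|\sum_i d 0 i| = \sum_i `|d 0 i|.
  apply/eqP; rewrite eq_le ler_norm_sum /= trC trA.
  rewrite (eq_bigr (fun=> 1)) // sumr_const card_ord rmorphM normrM /=.
  rewrite -pmulrn normr_nat ler_peMr ?ler0n //.
  by rewrite -intr_norm -[1]/(1%:~R) ler_int -gtz0_ge1 normr_gt0.
case/normC_sum_eq => t _ dt.
have [P uP defA] := dA.
have {}defA : complex_mx A = t%:M.
  have diag_t : diag_mx d = t%:M.
    rewrite -diag_const_mx; congr diag_mx; apply/rowP=> i.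
    by rewrite mxE (dt i isT) norm_d mul1r.
  by rewrite defA diag_t scalar_mxC -mulmxA mulVmx // mulmx1.
have [f eK fK] := e_bij.
have u0 g : g != 1%g -> u g = 0.
  move=> g1; have /matrixP/(_ (f 1%g) (f g)) := defA.
  rewrite !mxE !fK invg1 !mul1g (inj_eq (can_inj fK)) eq_sym (negPf g1).
  by move/eqP; rewrite intr_eq0 => /eqP.
have u_1 : u 1%g = 1.
  by rewrite -aug_u /augmentation (bigD1 1%g) //= big1 ?addr0.
by apply/eqP/ffunP=> g; rewrite ffunE; case: eqVneq => [-> // | /u0].
Qed.

End ClassFunctions.

(** * Permutation characters on the group ring *)
Section PermutationCharacter.
Variables (gT : finGroupType) (T : finType) (phi : gT -> {perm T}).
Hypothesis phiM : forall g h, phi (g * h)%g = (phi g * phi h)%g.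
Implicit Types (u v : group_alg int gT).

Definition perm_char g : int := (nfix (phi g))%:Z.

Lemma phi1 : phi 1%g = 1%g.
Proof. by apply: (mulgI (phi 1%g)); rewrite -phiM !mulg1. Qed.

Lemma perm_charJ : class_fun perm_char.
Proof.
have phiV g : phi g^-1%g = (phi g)^-1%g.
  by apply: (mulgI (phi g)); rewrite -phiM !mulgV phi1.
by move=> g h; rewrite /perm_char conjgE !phiM phiV -conjgE nfixJ.
Qed.

Variables (N : nat) (e : 'I_N.+1 -> T).
Hypothesis e_bij : bijective e.

Definition perm_repr u : 'M[int]_N.+1 :=
  \matrix_(i, j) \sum_(g | phi g (e i) == e j) u g.

Lemma perm_reprM u v : perm_repr (u * v) = perm_repr u * perm_repr v.
Proof.
apply/matrixP=> i j; rewrite !mxE.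
under eq_bigr do rewrite ffunE.
under [RHS]eq_bigr do rewrite !mxE mulr_suml.
rewrite exchange_big /= [RHS](exchange_big_dep xpredT) //=; apply: eq_bigr => h _.
have [f eK fK] := e_bij.
rewrite (big_pred1 (f (phi h (e i)))) => [|l]; last first.
  by rewrite /= -(inj_eq (can_inj eK)) fK eq_sym.
rewrite -mulr_sumr fK (reindex_inj (mulgI h)) /=; congr (_ * _).
by apply: eq_big => g; rewrite ?phiM ?permM ?mulKg.
Qed.

Lemma perm_repr1 : perm_repr 1 = 1.
Proof.
apply/matrixP=> i j; rewrite !mxE big_mkcond (bigD1 1%g) //= big1 ?addr0.
  rewrite phi1 perm1 ffunE eqxx (bij_eq e_bij).
  by case: (i == j).
by move=> g /negPf g1; rewrite ffunE g1 if_same.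
Qed.

Lemma perm_reprX u k : perm_repr (u ^+ k) = perm_repr u ^+ k.
Proof.
by elim: k => [|k IHk]; rewrite ?expr0 ?perm_repr1 // !exprS perm_reprM IHk.
Qed.

Lemma perm_repr_trace u : \tr (perm_repr u) = extend perm_char u.
Proof.
rewrite /mxtrace; under eq_bigr do rewrite mxE big_mkcond.
rewrite exchange_big /=; apply: eq_bigr => g _.
rewrite -big_mkcond sumr_const /= /perm_char -natz mulr_natr; congr (_ *+ _).
rewrite /nfix -(card_imset _ (bij_inj e_bij)); apply: eq_card => x.
rewrite !inE; apply/imsetP/eqP => [[i] | fix_x].
  by rewrite unfold_in => /eqP phi_i ->.
have [f eK fK] := e_bij; exists (f x); last by rewrite fK.
by apply/eqP; rewrite fK.
Qed.

End PermutationCharacter.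

Lemma perm_char_multiplicities (gT : finGroupType) (T : finType)
    (phi : gT -> {perm T}) (u : group_alg int gT) p q (t : T) :
    (forall g h, phi (g * h)%g = (phi g * phi h)%g) ->
    prime p -> prime q -> p != q -> u ^+ (p * q) = 1 ->
  exists a b c d : nat,
  [/\ #|T|%:Z = a%:Z + (p%:Z - 1) * b%:Z + (q%:Z - 1) * c%:Z
                + (p%:Z - 1) * (q%:Z - 1) * d%:Z,
      extend (perm_char phi) u = a%:Z - b%:Z - c%:Z + d%:Z,
      extend (perm_char phi) (u ^+ q) = a%:Z - b%:Z + (q%:Z - 1) * (c%:Z - d%:Z)
    & extend (perm_char phi) (u ^+ p) = a%:Z + (p%:Z - 1) * (b%:Z - d%:Z) - c%:Z].
Proof.
move=> phiM p_pr q_pr neq_pq u_pq; have [N [e e_bij cardN]] := ord_enumeration t.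
have A_pq : perm_repr phi e u ^+ (p * q) = 1.
  by rewrite -(perm_reprX phiM e_bij) u_pq perm_repr1.
have [a [b [c [d]]]] := pq_multiplicities p_pr q_pr neq_pq A_pq.
rewrite -!(perm_reprX phiM e_bij) !(perm_repr_trace phi e_bij) cardN.
by exists a, b, c, d.
Qed.

(** * A congruence modulo 2 between u and its square *)
Lemma sum_sym_mod2 (I : finType) (S : I -> I -> int) :
  (forall i j, S i j = S j i) ->
  exists k, \sum_i \sum_j S i j = \sum_i S i i + 2 * k.
Proof.
move=> symS; pose lt (i j : I) := (enum_rank i < enum_rank j)%N.
exists (\sum_i \sum_(j | lt i j) S i j).
have split_row i : \sum_j S i j =
    S i i + (\sum_(j | lt i j) S i j + \sum_(j | lt j i) S j i).
  rewrite (bigD1 i) //= (bigID (lt i)) /=; congr (_ + (_ + _)).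
    by apply: eq_bigl => j; rewrite /lt; case: eqVneq => // ->; rewrite ltnn.
  apply: eq_big => [j|j _]; last exact: symS.
  by rewrite /lt -leqNgt ltn_neqAle (inj_eq val_inj) (inj_eq enum_rank_inj).
under eq_bigr do rewrite split_row.
rewrite !big_split /=; congr (_ + _); rewrite mulr2n mulrDl !mul1r; congr (_ + _).
by rewrite (exchange_big_dep xpredT).
Qed.

Section UnitsModTwo.
Variable gT : finGroupType.
Implicit Types (u v : group_alg int gT) (f : gT -> int).

(** In the double sum for f (u * u) the terms of (g, h) and (h, g) agree, since
    g * h and h * g are conjugate; on the diagonal, (u g)^2 and u g have the
    same parity. *)
Lemma extend_square f u : class_fun f ->
  (2 %| extend f (u * u) - extend (fun g => f (g * g)%g) u)%Z.
Proof.
move=> f_class; have [|k eq_k] := @sum_sym_mod2 gT (fun g h => u g * u h * f (g * h)%g).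
  move=> g h; rewrite [u g * _]mulrC; congr (_ * _).
  by rewrite -(f_class (g * h)%g g) conjgE -mulgA mulKg.
have -> : extend f (u * u) = \sum_g u g * u g * f (g * g)%g + 2 * k.
  rewrite -eq_k /extend; under eq_bigr do rewrite ffunE mulr_suml.
  rewrite exchange_big /=; apply: eq_bigr => g _.
  by rewrite (reindex_inj (mulgI g)) /=; apply: eq_bigr => h _; rewrite mulKg.
rewrite addrAC rpredD ?dvdz_mulr // /extend -sumrB rpred_sum // => g _.
rewrite -mulrBl dvdz_mulr //; set a := u g.
have := divz_eq a 2; have := ltz_pmod a (isT : 0 < 2 :> int).
have := modz_ge0 a (isT : 2 != 0 :> int); move: (a %/ 2)%Z (a %% 2)%Z => b r r0 r2 ->.
apply/dvdzP; have [->|->] : r = 0 \/ r = 1 by lia.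
  by exists (2 * b * b - b); ring.
by exists (2 * b * b + b); ring.
Qed.

End UnitsModTwo.

(** * Values of permutation characters at torsion units *)
Section PairAction.
Variable T : finType.

Definition pair_fun (s : {perm T}) (ij : T * T) := (s ij.1, s ij.2).

Lemma pair_fun_inj s : injective (pair_fun s).
Proof. by move=> [i j] [k l] [/perm_inj-> /perm_inj->]. Qed.

Definition pair_perm s : {perm T * T} := perm (@pair_fun_inj s).

Lemma pair_permM s t : pair_perm (s * t)%g = (pair_perm s * pair_perm t)%g.
Proof. by apply/permP=> -[i j]; rewrite permM !permE /pair_fun !permM. Qed.

Lemma nfix_pair s : nfix (pair_perm s) = (nfix s ^ 2)%N.
Proof.
rewrite /nfix expnS expn1 -cardsX; apply: eq_card => -[i j].
by rewrite !inE permE /= xpair_eqE.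
Qed.

End PairAction.

Lemma augmentation_expr gT (u : group_alg int gT) k :
  augmentation u = 1 -> augmentation (u ^+ k) = 1.
Proof.
by move=> aug_u; elim: k => [|k IHk];
  rewrite ?expr0 ?augmentation1 // exprS augmentationM IHk aug_u.
Qed.

Section PrimeOrderParts.
Variables (gT : finGroupType) (u : group_alg int gT) (n : nat).
Hypotheses (n_gt0 : (0 < n)%N) (u_n : u ^+ n = 1).
Hypotheses (aug_u : augmentation u = 1) (u_neq1 : u != 1).
Implicit Types f : gT -> int.

(** Off the identity, where u vanishes, the difference of f and f' is supported on
    elements whose order does not divide n. *)
Lemma extend_eq f f' : class_fun f -> class_fun f' ->
    (forall g, g != 1%g -> (#[g]%g %| n)%N -> f g = f' g) ->
  extend f u = extend f' u.
Proof.
move=> f_class f'_class eq_f; have u1 := berman_higman n_gt0 u_n aug_u u_neq1.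
pose h g := if g == 1%g then 0 else f g - f' g.
have h_class : class_fun h by move=> g x; rewrite /h conjg_eq1 f_class f'_class.
have : extend h u = 0.
  apply: (extend_eq0 n_gt0 u_n h_class) => g gn; rewrite /h.
  by case: eqVneq => // g1; rewrite eq_f ?subrr.
move/eqP; rewrite /extend; apply: contraTeq; rewrite -subr_eq0 -sumrB => neq_f.
apply: contra neq_f => /eqP h0; rewrite -[X in _ == X]h0; apply/eqP.
apply: eq_bigr => g _; rewrite /h -mulrBr.
by case: eqVneq => // ->; rewrite u1 !mul0r.
Qed.

Lemma extend_const c : extend (fun=> c) u = c.
Proof. by rewrite /extend -mulr_suml -/(augmentation u) aug_u mul1r. Qed.

Lemma extend_lin a f b f' :
  extend (fun g => a * f g + b * f' g) u = a * extend f u + b * extend f' u.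
Proof.
by rewrite /extend !mulr_sumr -big_split; apply: eq_bigr => g _ /=; ring.
Qed.

Definition order_ind k (g : gT) : int := (#[g]%g == k)%:R.

(** Otherwise the constant functions 0 and 1 would have the same extension at u. *)
Lemma exists_order_dvd : exists2 g : gT, g != 1%g & (#[g]%g %| n)%N.
Proof.
have [/existsP[g /andP[]] | no_g] := boolP [exists g : gT, (g != 1%g) && (#[g]%g %| n)%N].
  by exists g.
have := @extend_eq (fun=> 1) (fun=> 0) (fun _ _ => erefl) (fun _ _ => erefl).
rewrite !extend_const => contra01; have /eqP := oner_neq0 int; case.
apply: contra01 => g g1 gn; case/existsP: no_g.
by exists g; rewrite g1 gn.
Qed.

End PrimeOrderParts.

(** * Units of order pq when the group is isomorphic to M24 *)
Lemma class_fun_lin (gT : finGroupType) a b (f f' : gT -> int) :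
  class_fun f -> class_fun f' -> class_fun (fun g => a * f g + b * f' g).
Proof. by move=> cf cf' g x; rewrite cf cf'. Qed.

Section HeLP.
Variables (gT : finGroupType) (phi : gT -> 'S_24).
Hypothesis phiM : forall g h, phi (g * h)%g = (phi g * phi h)%g.
Hypothesis phi_M24 : forall g, phi g \in M24.
Hypothesis phi_order : forall g, #[phi g]%g = #[g]%g.
Implicit Types (g : gT) (u : group_alg int gT).

Local Notation chi := (perm_char phi).
Definition phi2 g := pair_perm (phi g).
Local Notation chi2 := (perm_char phi2).

Lemma phi2M g h : phi2 (g * h)%g = (phi2 g * phi2 h)%g.
Proof. by rewrite /phi2 phiM pair_permM. Qed.

Lemma chi2E g : chi2 g = chi g ^+ 2.
Proof. by rewrite /perm_char nfix_pair expr2 -PoszM mulnn. Qed.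

(** The number of fixed points of an element of order p, when it is not 0. *)
Definition fixpoints p : nat := (nth 0 [:: 0; 0; 8; 6; 0; 4; 0; 3; 0; 0; 0; 2] p + (p == 23))%N.

Definition fix_ind p g : int := ((#[g]%g == p) && (nfix (phi g) == fixpoints p))%:R.

Lemma fix_ind_class p : class_fun (fix_ind p).
Proof.
move=> g x; rewrite /fix_ind orderJ.
by have [->] := perm_charJ phiM g x.
Qed.

Lemma fix_ind_ge5 p : prime p -> (4 < p)%N -> fix_ind p =1 order_ind p.
Proof.
move=> p_pr p5 g; rewrite /fix_ind /order_ind; case: eqP => //= og.
have := M24_prime_fix (phi_M24 g) p_pr; rewrite phi_order => /(_ og).
rewrite !inE !xpair_eqE.
by do ![case/orP] => /andP[/eqP eq_p /eqP->]; move: p5; rewrite eq_p.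
Qed.

Lemma chi_prime g p : prime p -> #[g]%g = p ->
  chi g = (fixpoints p)%:Z * fix_ind p g.
Proof.
move=> p_pr og; rewrite /fix_ind /perm_char og eqxx.
have := M24_prime_fix (phi_M24 g) p_pr; rewrite phi_order => /(_ og).
rewrite !inE !xpair_eqE.
by do ![case/orP] => /andP[/eqP eq_p /eqP->]; rewrite eq_p.
Qed.

Lemma chi2_prime g p : prime p -> #[g]%g = p ->
  chi2 g = (fixpoints p)%:Z ^+ 2 * fix_ind p g.
Proof.
move=> p_pr og; rewrite chi2E (chi_prime p_pr og) exprMn; congr (_ * _).
by rewrite /fix_ind; case: (_ && _).
Qed.

Lemma prime_unit_values v p : prime p -> v ^+ p = 1 -> augmentation v = 1 ->
  v != 1 -> exists e : int,
  [/\ extend chi v = (fixpoints p)%:Z * e,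
      extend chi2 v = (fixpoints p)%:Z ^+ 2 * e & (4 < p)%N -> e = 1].
Proof.
move=> p_pr vp aug_v v1; have p_gt0 := prime_gt0 p_pr.
exists (extend (fix_ind p) v).
have ord_p g : g != 1%g -> (#[g]%g %| p)%N -> #[g]%g = p.
  by move=> g1 /(prime_nt_dvdP p_pr); rewrite order_eq1 => ->.
have ind_class := fix_ind_class.
split.
- rewrite (extend_eq p_gt0 vp aug_v v1 (perm_charJ phiM)
    (class_fun_lin (fixpoints p)%:Z 0 (ind_class p) (ind_class p))) => [|g g1 gp].
    by rewrite extend_lin mul0r addr0.
  by rewrite (chi_prime p_pr (ord_p g g1 gp)) mul0r addr0.
- rewrite (extend_eq p_gt0 vp aug_v v1 (perm_charJ phi2M)
    (class_fun_lin ((fixpoints p)%:Z ^+ 2) 0 (ind_class p) (ind_class p))) => [|g g1 gp].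
    by rewrite extend_lin mul0r addr0.
  by rewrite (chi2_prime p_pr (ord_p g g1 gp)) mul0r addr0.
move=> p5; rewrite -[RHS](extend_const aug_v 1).
apply: (extend_eq p_gt0 vp aug_v v1) => // g g1 gp.
by rewrite (fix_ind_ge5 p_pr p5) /order_ind (ord_p g g1 gp) eqxx.
Qed.

Section OneUnit.
Variables (u : group_alg int gT) (p q : nat).
Hypotheses (p_pr : prime p) (q_pr : prime q) (neq_pq : p != q).
Hypotheses (u_pq : u ^+ (p * q) = 1) (aug_u : augmentation u = 1).
Hypotheses (u_neq1 : u != 1) (uq_neq1 : u ^+ q != 1) (up_neq1 : u ^+ p != 1).
Hypothesis no_pq : forall g, #[g]%g <> (p * q)%N.

Let pq_gt0 : (0 < p * q)%N.
Proof. by rewrite muln_gt0 !prime_gt0. Qed.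

(** The divisors of p q are 1, p, q and p q. *)
Lemma order_p_or_q g : g != 1%g -> (#[g]%g %| p * q)%N ->
  #[g]%g = p \/ #[g]%g = q.
Proof.
rewrite -order_eq1; set o := #[g]%g => o1 o_pq.
have [po | npo] := boolP (p %| o)%N.
  left; case/dvdnP: po => k def_o; move: o_pq; rewrite def_o [(k * p)%N]mulnC.
  rewrite dvdn_pmul2l ?prime_gt0 // => kq.
  have [k1 | k1] := eqVneq k 1%N; first by rewrite k1 muln1.
  by case: (@no_pq g); rewrite -/o def_o (prime_nt_dvdP q_pr k1 kq) mulnC.
right; move: o_pq; rewrite Gauss_dvdr; first by move/(prime_nt_dvdP q_pr o1).
by rewrite coprime_sym prime_coprime.
Qed.

(** The integers x and z are the sums of the coefficients of u over the elements of
    order p, respectively q, that have fixed points.  For p = 2, extend_square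
    compares z with its analogue for u ^+ 2, which is 1; the elements of order
    2 contribute nothing to it since their square is 1. *)
Lemma mixed_unit_values : exists x z : int,
  [/\ extend chi u = (fixpoints p)%:Z * x + (fixpoints q)%:Z * z,
      extend chi2 u = (fixpoints p)%:Z ^+ 2 * x + (fixpoints q)%:Z ^+ 2 * z
    & p = 2%N -> (4 < q)%N -> (2 %| z - 1)%Z].
Proof.
exists (extend (fix_ind p) u), (extend (fix_ind q) u).
have ind0 r s g : r != s -> #[g]%g = r -> fix_ind s g = 0.
  by move=> neq_rs og; rewrite /fix_ind og (negPf neq_rs).
have neq_qp : q != p by rewrite eq_sym.
split.
- rewrite -extend_lin; apply: (extend_eq pq_gt0 u_pq aug_u u_neq1 (perm_charJ phiM)).
    exact: class_fun_lin (fix_ind_class p) (fix_ind_class q).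
  move=> g g1 /(order_p_or_q g1)[]og.
    by rewrite (chi_prime p_pr og) (ind0 _ _ _ neq_pq og) mulr0 addr0.
  by rewrite (chi_prime q_pr og) (ind0 _ _ _ neq_qp og) mulr0 add0r.
- rewrite -extend_lin; apply: (extend_eq pq_gt0 u_pq aug_u u_neq1 (perm_charJ phi2M)).
    exact: class_fun_lin (fix_ind_class p) (fix_ind_class q).
  move=> g g1 /(order_p_or_q g1)[]og.
    by rewrite (chi2_prime p_pr og) (ind0 _ _ _ neq_pq og) mulr0 addr0.
  by rewrite (chi2_prime q_pr og) (ind0 _ _ _ neq_qp og) mulr0 add0r.
move=> p2 q5; have := extend_square u (fix_ind_class q).
have uu : u * u = u ^+ p by rewrite p2 expr2.
have up_q : (u ^+ p) ^+ q = 1 by rewrite -exprM.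
have aug_up k : augmentation (u ^+ k) = 1 by apply: augmentation_expr.
rewrite uu; have -> : extend (fix_ind q) (u ^+ p) = 1.
  rewrite -[RHS](extend_const (aug_up p) 1).
  apply: (extend_eq (prime_gt0 q_pr) up_q (aug_up p) up_neq1 (fix_ind_class q)) => // g g1.
  move/(prime_nt_dvdP q_pr) => oq; rewrite (fix_ind_ge5 q_pr q5) /order_ind.
  by rewrite oq ?order_eq1 ?eqxx.
have -> : extend (fun g => fix_ind q (g * g)%g) u = extend (fix_ind q) u.
  apply: (extend_eq pq_gt0 u_pq aug_u u_neq1) => [g x||g g1].
  - by rewrite -conjMg fix_ind_class.
  - exact: fix_ind_class.
  rewrite !(fix_ind_ge5 q_pr q5) /order_ind => /(order_p_or_q g1)[]og.
    have -> : (g * g = 1)%g by have := expg_order g; rewrite og p2 expgS expg1.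
    by rewrite og order1 (negPf neq_pq) ltn_eqF ?prime_gt1.
  suff -> : #[g * g]%g = q by rewrite og.
  have -> : (g * g = g ^+ 2)%g by rewrite expgS expg1.
  have /eqP co_q2 : coprime q 2 by rewrite prime_coprime // gtnNdvd // (leq_trans _ q5).
  by rewrite orderXgcd og co_q2 divn1.
by rewrite -rpredN opprB.
Qed.

(** For every other product p q, the multiplicities in the permutation characters
    on points and on pairs would satisfy a linear system over the natural numbers
    (with a parity condition when p = 2) which has no solution. *)
Lemma mixed_unit_order : (p < q)%N ->
    p \in [:: 2; 3; 5; 7; 11; 23]%N -> q \in [:: 2; 3; 5; 7; 11; 23]%N ->
  (p * q)%N \in [:: 6; 10; 14; 15; 21]%N.
Proof.
move=> lt_pq p_in q_in.
have aug_uX k : augmentation (u ^+ k) = 1 by apply: augmentation_expr.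
have uq_p : (u ^+ q) ^+ p = 1 by rewrite -exprM mulnC.
have up_q : (u ^+ p) ^+ q = 1 by rewrite -exprM.
have [e [v1 v2 e1]] := prime_unit_values p_pr uq_p (aug_uX q) uq_neq1.
have [f [w1 w2 f1]] := prime_unit_values q_pr up_q (aug_uX p) up_neq1.
have [x [z [u1 u2 z_odd]]] := mixed_unit_values.
have [a [b [c [d]]]] :=
  perm_char_multiplicities (ord0 : 'I_24) phiM p_pr q_pr neq_pq u_pq.
have [a' [b' [c' [d']]]] :=
  perm_char_multiplicities ((ord0, ord0) : 'I_24 * 'I_24) phi2M p_pr q_pr neq_pq u_pq.
rewrite u1 u2 v1 v2 w1 w2 card_prod card_ord.
move: p_in q_in lt_pq e1 f1 z_odd; rewrite !inE.
do ![case/orP] => /eqP-> ; do ![case/orP] => /eqP-> //= _.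
all: rewrite /fixpoints /= => e1 f1 z_odd [A1 A2 A3 A4] [B1 B2 B3 B4].
all: try have {}e1 := e1 isT.
all: try have {}f1 := f1 isT.
all: subst.
all: clear -A1 A2 A3 A4 B1 B2 B3 B4 z_odd; rewrite ?expr2 /= in A2 A3 A4 B2 B3 B4 z_odd; exfalso.
all: try (have {z_odd} := z_odd erefl isT).
all: lia.
Qed.
End OneUnit.
End HeLP.

(** * The group inside its unit group, and the conclusion *)
Section Embedding.
Variable gT : finGroupType.
Implicit Types g h : gT.

Lemma galg_monM g h :
  galg_mon 1 g * galg_mon 1 h = galg_mon 1 (g * h)%g :> group_alg int gT.
Proof.
apply/ffunP=> x; rewrite !ffunE (bigD1 g) //= !ffunE eqxx mul1r big1 ?addr0.
  by rewrite -(inj_eq (mulgI g)) mulKVg.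
by move=> y /negPf ne_yg; rewrite ffunE ne_yg mul0r.
Qed.

Lemma augmentation_mon g : augmentation (galg_mon (1 : int) g) = 1.
Proof.
rewrite /augmentation (bigD1 g) //= ffunE eqxx big1 ?addr0 // => h /negPf gh.
by rewrite ffunE gh.
Qed.

Lemma mon_unit_subproof g :
  let p : group_alg int gT * group_alg int gT :=
    (galg_mon 1 g, galg_mon 1 g^-1%g) in
  [&& augmentation p.1 == 1, p.1 * p.2 == 1 & p.2 * p.1 == 1].
Proof. by rewrite /= augmentation_mon !galg_monM mulgV mulVg !eqxx. Qed.

Definition mon_unit g : norm_unit gT := NormUnit (mon_unit_subproof g).

Lemma mon_unitX g k : (mon_unit g ^+ k = mon_unit (g ^+ k))%g.
Proof.
apply: nu_elt_inj; rewrite nu_eltX.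
elim: k => [|k IHk]; first by rewrite expr0 expg0.
by rewrite exprS IHk /nu_elt /= galg_monM expgS.
Qed.

Lemma mon_unit_eq1 g : mon_unit g = 1%g -> g = 1%g.
Proof.
move/(congr1 (@nu_elt gT))/ffunP/(_ g); rewrite /nu_elt /= !ffunE eqxx.
by case: eqP => // _ /eqP; rewrite oner_eq0.
Qed.

Lemma mon_unit_order g n : elt_order g n -> elt_order (mon_unit g) n.
Proof.
case=> n_gt0 gn lt_n; split=> //; first by rewrite mon_unitX gn; apply: nu_elt_inj.
by move=> k /lt_n gk; rewrite mon_unitX => /mon_unit_eq1.
Qed.

Lemma unit_order n (x : norm_unit gT) : elt_order x n ->
  [/\ (0 < n)%N, nu_elt x ^+ n = 1 &
      forall k, (0 < k < n)%N -> nu_elt x ^+ k != 1].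
Proof.
case=> n_gt0 xn lt_n; split=> // [|k /lt_n xk].
  by rewrite -nu_eltX xn.
by apply/eqP=> uk; case: xk; apply: nu_elt_inj; rewrite nu_eltX uk.
Qed.

Lemma nu_augmentation (x : norm_unit gT) : augmentation (nu_elt x) = 1.
Proof. by case: (nu_spec x). Qed.

Lemma unit_prime_order p (u : group_alg int gT) : prime p -> u ^+ p = 1 -> u != 1 ->
  augmentation u = 1 -> exists g : gT, #[g]%g = p.
Proof.
move=> p_pr up u1 aug_u.
have [g g1 gp] := exists_order_dvd (prime_gt0 p_pr) up aug_u u1.
by exists g; apply: (prime_nt_dvdP p_pr) gp; rewrite order_eq1.
Qed.

End Embedding.

Theorem corollary1 (gT : finGroupType) (hG : [set: gT]%G \isog M24) :
  same_prime_graph gT (norm_unit gT).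
Proof.
have [f /injmP f_inj f_im] := isogP hG.
pose phi g := f g.
have phiM g h : phi (g * h)%g = (phi g * phi h)%g by rewrite /phi morphM ?inE.
have phi_M24 g : phi g \in M24 by rewrite -f_im mem_morphim ?inE.
have phi_order g : #[phi g]%g = #[g]%g.
  by rewrite /phi order_injm ?inE //; apply/injmP.
have prime_list p g : prime p -> #[g : gT]%g = p -> p \in [:: 2; 3; 5; 7; 11; 23]%N.
  move=> p_pr og; have := M24_prime_fix (phi_M24 g) p_pr; rewrite phi_order => /(_ og).
  by rewrite !inE !xpair_eqE; do ![case/orP] => /andP[/eqP-> _].
have good n : n \in [:: 6; 10; 14; 15; 21]%N -> exists g : gT, #[g]%g = n.
  move=> /M24_element_orders[s]; rewrite -f_im => /morphimP[g _ _ ->] <-.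
  by exists g; rewrite -phi_order.
split=> [p | p q]; split.
- by case=> p_pr [g gp]; split=> //; exists (mon_unit g); apply: mon_unit_order.
- case=> p_pr [x /unit_order[_ up u1]]; split=> //.
  have [|g og] := unit_prime_order p_pr up _ (nu_augmentation x).
    by rewrite -[nu_elt x]expr1 u1 // prime_gt1.
  by exists g; apply/elt_orderE.
- case=> p_pr q_pr neq_pq [g gpq]; split=> //.
  by exists (mon_unit g); apply: mon_unit_order.
case=> p_pr q_pr neq_pq [x /unit_order[pq_gt0 u_pq u_neq1]]; split=> //.
have aug_u := nu_augmentation x; move: (nu_elt x) u_pq u_neq1 aug_u => u u_pq u_neq1 aug_u.
suff [g og] : exists g : gT, #[g]%g = (p * q)%N by exists g; apply/elt_orderE.
have [/existsP[g /eqP og] | no_g] := boolP [exists g : gT, #[g]%g == (p * q)%N].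
  by exists g.
have no_pq (g : gT) : #[g]%g <> (p * q)%N.
  by move=> og; case/existsP: no_g; exists g; apply/eqP.
apply: good.
wlog lt_pq: p q p_pr q_pr neq_pq u_pq u_neq1 no_pq {pq_gt0 no_g} / (p < q)%N.
  move=> IH; have [/IH-> // | ltqp | /neq_pq //] := ltngtP p q.
  rewrite mulnC in u_pq u_neq1 no_pq *.
  by apply: IH => // eq_qp; apply: neq_pq.
have [p_gt1 q_gt1] := (prime_gt1 p_pr, prime_gt1 q_pr).
have u1 : u != 1 by rewrite -[u]expr1 u_neq1 //= -[1%N]mul1n ltn_mul.
have uq1 : u ^+ q != 1 by rewrite u_neq1 // prime_gt0 //= ltn_Pmull // prime_gt0.
have up1 : u ^+ p != 1 by rewrite u_neq1 // prime_gt0 //= ltn_Pmulr // prime_gt0.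
have aug_uX k : augmentation (u ^+ k) = 1 by apply: augmentation_expr.
have [g og] : exists g : gT, #[g]%g = p.
  by apply: (@unit_prime_order _ p (u ^+ q)); rewrite // -exprM mulnC.
have [h oh] : exists h : gT, #[h]%g = q.
  by apply: (@unit_prime_order _ q (u ^+ p)); rewrite // -exprM.
have neq_pq' : p != q by apply/eqP.
exact: (@mixed_unit_order gT phi phiM phi_M24 phi_order u p q p_pr q_pr neq_pq'
  u_pq aug_u u1 uq1 up1 no_pq lt_pq (prime_list _ _ p_pr og) (prime_list _ _ q_pr oh)).
Qed.
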